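(* Consider algorithm ALFCG-FS (defined in the context) applied to $\min_{x\in\mathcal X}F(x)=f(x)+h(x)$ with $f=\frac1N\sum_{i=1}^Nf_i$, each $f_i$ being $L$-smooth on $\mathcal X$. Let $\kappa=1+\rho D$, $L'=4\rho^3D^2+4L\kappa+16L^2\frac{q\kappa^q}{b\rho}+\rho$, $\omega=\frac{L\kappa^2}{\rho^2}+\frac{4L^2}{b\rho^3}q\kappa^{q+1}$, $\lambda=\frac1{8\rho^2\omega}$, $\overline F=2\big(F(x_0)-F_*+\rho D^2+\omega|\ln\rho|+\omega|\ln\lambda|+\omega\lambda L'\big)$, $\overline L=L'+4\rho^2\overline F$, and $C=\frac{\overline F\cdot\overline L}{\rho}$. (a) For every integer $T\ge0$, the expected average Frank-Wolfe gap satisfies $\mathbb E\big[\frac1{T+1}\sum_{t=0}^T\mathcal G(x_t)\big]\le\frac{C}{\sqrt{T+1}}$. Consequently, for any $\epsilon>0$, the algorithm finds an $\epsilon$-approximate solution in expectation, i.e. $\mathbb E[\min_{0\le t\le T}\mathcal G(x_t)]\le\epsilon$, within at most $T=\lceil C^2\epsilon^{-2}-1\rceil$ iterations. (b) Assume $b=q=\sqrt N$. The total complexity in expectation (number of component-gradient evaluations) required to find an $\epsilon$-approximate critical point is $\mathcal O(N+\sqrt N\epsilon^{-2})$, where $C$ is treated as a constant hidden by $\mathcal O(\cdot)$.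
   Context: Problem: $\mathcal X\subset\mathbb R^n$ is compact and convex with finite diameter $D=\sup_{x,y\in\mathcal X}\|x-y\|$ (Euclidean norm); $h:\mathbb R^n\to(-\infty,+\infty]$ is proper, closed and convex; $f=\frac1N\sum_{i=1}^Nf_i$ with each $f_i$ differentiable and $\|\nabla f_i(x)-\nabla f_i(y)\|\le L\|x-y\|$ for all $x,y\in\mathcal X$ ($L>0$); $F=f+h$; $\mathrm{dom}(F)\cap\mathcal X\ne\emptyset$, and $F_*=\inf_{x\in\mathcal X}F(x)$ is finite and attained. Frank-Wolfe gap: $\mathcal G(x)=\max_{v\in\mathcal X}\{\langle\nabla f(x),x-v\rangle+h(x)-h(v)\}$. Algorithm ALFCG-FS: parameters $\rho>0$, integers $q\ge1$ (epoch length) and $b\ge1$ (mini-batch size); start at $x_0\in\mathcal X\cap\mathrm{dom}(h)$. For $t=0,1,2,\dots$: sample a mini-batch $\xi_t$ of $b$ indices drawn i.i.d. uniformly from $\{1,\dots,N\}$, independently of the past, and write $\nabla f(x;\xi_t)=\frac1b\sum_{i\in\xi_t}\nabla f_i(x)$; set $L_t=\rho\big(1+\sum_{i=0}^{t-1}L_i^2\|x_{i+1}-x_i\|^2\big)^{1/2}$ (so $L_0=\rho$); set $g_t=\nabla f(x_t)$ if $q$ divides $t$, and $g_t=g_{t-1}+\nabla f(x_t;\xi_t)-\nabla f(x_{t-1};\xi_t)$ otherwise; $v_t\in\arg\min_{v\in\mathcal X}\langle v,g_t\rangle+h(v)$; $x_{t+1}=x_t+\bar\eta_t(v_t-x_t)$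 with $\bar\eta_t=\min\Big(\frac{h(x_t)-h(v_t)-\langle g_t,v_t-x_t\rangle}{L_t\|v_t-x_t\|^2},1\Big)$ (if $v_t=x_t$, then $x_{t+1}=x_t$). *)

(* Defs.v *)
From HB Require Import structures.
From mathcomp Require Import all_boot all_order all_algebra.
From mathcomp Require Import all_classical all_reals all_analysis.

Set Implicit Arguments.
Unset Strict Implicit.
Unset Printing Implicit Defensive.

Import Order.TTheory GRing.Theory Num.Theory.
Import numFieldNormedType.Exports.

Local Open Scope classical_set_scope.
Local Open Scope ring_scope.

(* The library norm `|x| on 'rV[R]_n is the sup norm, hence norm2; both norms
   induce the same topology, so compact, closed and differentiable are the
   library notions. *)
Definition dot (R : realType) (n : nat) (x y : 'rV[R]_n) : R :=
  \sum_(j < n) x 0 j * y 0 j.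

Definition norm2 (R : realType) (n : nat) (x : 'rV[R]_n) : R :=
  Num.sqrt (dot x x).

Definition diam (R : realType) (n : nat) (X : set 'rV[R]_n) : R :=
  sup [set norm2 (z.1 - z.2) | z in X `*` X].

(* The vector of partial derivatives. *)
Definition grad (R : realType) (n : nat) (phi : 'rV[R]_n -> R) (x : 'rV[R]_n) :
    'rV[R]_n :=
  \row_(j < n) 'D_(delta_mx 0 j) (phi : 'rV[R]_n -> R^o) x.

Definition proper (R : realType) (n : nat) (h : 'rV[R]_n -> \bar R) : Prop :=
  (forall x, h x != -oo%E) /\ (exists x, h x != +oo%E).

(* h is closed when its epigraph is a closed subset of R^n x R. *)
Definition closed_fun (R : realType) (n : nat) (h : 'rV[R]_n -> \bar R) : Prop :=
  closed [set z : 'rV[R]_n * R^o | (h z.1 <= z.2%:E)%E].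

Definition convex_efun (R : realType) (n : nat) (h : 'rV[R]_n -> \bar R) : Prop :=
  forall (x y : 'rV[R]_n) (a : R), 0 <= a <= 1 ->
    (h (a *: x + (1 - a) *: y)%R <= a%:E * h x + (1 - a)%:E * h y)%E.

Record problem (R : realType) (n N : nat) := Problem {
  feasible : set 'rV[R]_n;
  component : 'I_N -> 'rV[R]_n -> R;
  reg : 'rV[R]_n -> \bar R;
  smooth : R
}.

Section Objective.
Context {R : realType} {n N : nat} (p : problem R n N).
Local Notation X := (feasible p).
Local Notation h := (reg p).
Local Notation L := (smooth p).

Definition favg (x : 'rV[R]_n) : R := N%:R^-1 * \sum_(i < N) component p i x.

Definition objective (x : 'rV[R]_n) : \bar R := ((favg x)%:E + h x)%E.

Definition optval : \bar R := ereal_inf (objective @` X).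

Record standing_assumptions : Prop := {
  N_gt0 : (0 < N)%N;
  X_compact : compact X;
  X_convex : convex_set X;
  h_proper : proper h;
  h_closed : closed_fun h;
  h_convex : convex_efun h;
  L_gt0 : 0 < L;
  f_differentiable : forall i x,
    differentiable (component p i : 'rV[R]_n -> R^o) x;
  f_smooth : forall i x y, X x -> X y ->
    norm2 (grad (component p i) x - grad (component p i) y)
      <= L * norm2 (x - y);
  dom_meets_X : exists2 x, X x & (objective x < +oo)%E;
  optval_finite : optval \is a fin_num;
  optval_attained : exists2 x, X x & objective x = optval
}.

(* Under the standing assumptions the supremum is attained whenever x lies in
   the domain of h, because v |-> <grad f x, v> + h v is lower semicontinuous
   and X is compact. *)
Definition fw_gap (x : 'rV[R]_n) : \bar R :=
  ereal_sup [set ((dot (grad favg x) (x - v))%:E + h x - h v)%E | v in X].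

Definition batch_grad (b : nat) (xi : b.-tuple 'I_N) (x : 'rV[R]_n) : 'rV[R]_n :=
  b%:R^-1 *: \sum_(j < b) grad (component p (tnth xi j)) x.

End Objective.

Section Algorithm.
Context {R : realType} {n N b : nat} {d : measure_display}
  {Omega : measurableType d}.

Record process := Process {
  batch : nat -> Omega -> b.-tuple 'I_N;
  Lest : nat -> Omega -> R;
  gest : nat -> Omega -> 'rV[R]_n;
  lmo : nat -> Omega -> 'rV[R]_n;
  iterate : nat -> Omega -> 'rV[R]_n
}.

(* The events observable just before the t-th mini-batch is drawn; the past at
   time t is the sigma-algebra they generate. *)
Definition observable (s : process) (t : nat) : set (set Omega) :=
  [set E | [\/
    exists i, exists j : 'I_b, exists k : 'I_N, (i < t)%N /\
      E = [set w | tnth (batch s i w) j = k],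
    exists i, exists j : 'I_n, exists2 B : set R, (i < t)%N /\ measurable B &
      E = (fun w => gest s i w 0 j) @^-1` B,
    exists i, exists j : 'I_n, exists2 B : set R, (i < t)%N /\ measurable B &
      E = (fun w => lmo s i w 0 j) @^-1` B |
    exists i, exists j : 'I_n, exists2 B : set R, (i <= t)%N /\ measurable B &
      E = (fun w => iterate s i w 0 j) @^-1` B]].

Definition past (s : process) (t : nat) : set (set Omega) := <<s observable s t >>.

Variables (P : probability Omega R) (p : problem R n N).
Local Notation X := (feasible p).
Local Notation h := (reg p).

(* When v = x the quotient is 0, division by zero being 0; the update then
   gives back x. *)
Definition step_size (Lt : R) (g v x : 'rV[R]_n) : R :=
  Num.min (fine (h x - h v - (dot g (v - x))%:E)%E / (Lt * norm2 (v - x) ^+ 2)) 1.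

Record alfcg_fs (rho : R) (q : nat) (x0 : 'rV[R]_n) (s : process) : Prop := {
  observable_measurable : forall t, observable s t `<=` measurable;
  batch_uniform : forall t (j : 'I_b) (k : 'I_N),
    P [set w | tnth (batch s t w) j = k] = (N%:R^-1)%:E;
  batch_independent : forall t (u : b.-tuple 'I_N),
    P [set w | batch s t w = u] =
      (\prod_(j < b) P [set w | tnth (batch s t w) j = tnth u j])%E;
  batch_past_independent : forall t (u : b.-tuple 'I_N) A, past s t A ->
    P (A `&` [set w | batch s t w = u]) = (P A * P [set w | batch s t w = u])%E;
  iterate0 : forall w, iterate s 0 w = x0;
  Lest_rule : forall t w, Lest s t w = rho * Num.sqrt
    (1 + \sum_(i < t) Lest s i w ^+ 2
           * norm2 (iterate s i.+1 w - iterate s i w) ^+ 2);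
  gest_full : forall t w, (q %| t)%N -> gest s t w = grad (favg p) (iterate s t w);
  gest_recursive : forall t w, ~~ (q %| t.+1)%N ->
    gest s t.+1 w = gest s t w
      + batch_grad p (batch s t.+1 w) (iterate s t.+1 w)
      - batch_grad p (batch s t.+1 w) (iterate s t w);
  lmo_feasible : forall t w, X (lmo s t w);
  lmo_argmin : forall t w v, X v ->
    ((dot (lmo s t w) (gest s t w))%:E + h (lmo s t w)
       <= (dot v (gest s t w))%:E + h v)%E;
  iterate_rule : forall t w, iterate s t.+1 w = iterate s t w
    + step_size (Lest s t w) (gest s t w) (lmo s t w) (iterate s t w)
        *: (lmo s t w - iterate s t w)
}.

Definition avg_gap (s : process) (T : nat) (w : Omega) : \bar R :=
  ((T.+1%:R^-1)%:E * \sum_(t < T.+1) fw_gap p (iterate s t w))%E.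

Definition min_gap (s : process) (T : nat) (w : Omega) : \bar R :=
  (\big[Order.min/+oo]_(t < T.+1) fw_gap p (iterate s t w))%E.

End Algorithm.

Arguments process : clear implicits.

(* Component gradients evaluated in iterations 0, ..., T: a full gradient costs
   N evaluations, a recursive update evaluates its b sampled components at both
   x_t and x_(t-1). The count is the same for every outcome, so it equals its
   expectation. *)
Definition grad_evals (N q b T : nat) : nat :=
  \sum_(t < T.+1) (if (q %| t)%N then N else (2 * b)%N).

Section Constants.
Context {R : realType} {n N : nat}.
Variables (p : problem R n N) (rho : R) (q b : nat) (x0 : 'rV[R]_n).
Local Notation D := (diam (feasible p)).
Local Notation L := (smooth p).

Definition kappa : R := 1 + rho * D.

Definition L_prime : R :=
  4 * rho ^+ 3 * D ^+ 2 + 4 * L * kappa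
  + 16 * L ^+ 2 * (q%:R * kappa ^+ q / (b%:R * rho)) + rho.

Definition omega : R :=
  L * kappa ^+ 2 / rho ^+ 2
  + 4 * L ^+ 2 / (b%:R * rho ^+ 3) * q%:R * kappa ^+ q.+1.

Definition lambda : R := (8 * rho ^+ 2 * omega)^-1.

Definition F_bar : R :=
  2 * (fine (objective p x0) - fine (optval p) + rho * D ^+ 2
       + omega * `|ln rho| + omega * `|ln lambda| + omega * lambda * L_prime).

Definition L_bar : R := L_prime + 4 * rho ^+ 2 * F_bar.

Definition gap_const : R := F_bar * L_bar / rho.

End Constants.

(* Main.v *)
Require Import Defs.
From HB Require Import structures.
From mathcomp Require Import all_boot all_order all_algebra.
From mathcomp Require Import all_classical all_reals all_analysis.
From mathcomp Require Import measurable_realfun.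
From mathcomp Require Import ring lra.

(* The gap estimated with the stochastic gradient controls both the decrease of [F] and the
   squared step lengths, up to the weighted errors [norm2 (err t) ^+ 2 / Lest t].
   Conditionally on the past, a recursive update adds at most
   [L^2 / b * norm2 (x_(t+1) - x_t) ^+ 2] to the squared error, and [Lest] is nondecreasing
   and known before the batch is drawn, so the expected weighted errors are bounded by
   [L^2 q / b] times the expected weighted squared moves.  Since [Lest] accumulates these
   moves, their sum is at most a multiple of [ln (Lest T)], while [Lest T] is at most affine in
   the total progress; absorbing the logarithm bounds the expected progress by [F_bar].
   AM-GM with weight [sqrt T] then turns progress and errors into the bound on the gaps.

   Everything except the error recursion is an inequality along each trajectory, and the
   gaps are dominated by an affine function of the error and move sums, so that their own
   measurability never matters. *)

Set Implicit Arguments.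
Unset Strict Implicit.
Unset Printing Implicit Defensive.

Import Order.TTheory GRing.Theory Num.Theory.
Import numFieldNormedType.Exports.

Local Open Scope classical_set_scope.
Local Open Scope ring_scope.

(** * Euclidean space *)

Section Euclidean.
Context {R : realType} {n : nat}.
Implicit Types x y z : 'rV[R]_n.

Lemma dotC x y : dot x y = dot y x.
Proof. by apply: eq_bigr => j _; rewrite mulrC. Qed.

Lemma dotDl x y z : dot (x + y) z = dot x z + dot y z.
Proof. by rewrite -big_split; apply: eq_bigr => j _; rewrite !mxE mulrDl. Qed.

Lemma dotZl a x y : dot (a *: x) y = a * dot x y.
Proof. by rewrite /dot mulr_sumr; apply: eq_bigr => j _; rewrite !mxE mulrA. Qed.

Lemma dotNl x y : dot (- x) y = - dot x y.
Proof. by rewrite -scaleN1r dotZl mulN1r. Qed.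

Lemma dotBl x y z : dot (x - y) z = dot x z - dot y z.
Proof. by rewrite dotDl dotNl. Qed.

Lemma dotDr x y z : dot x (y + z) = dot x y + dot x z.
Proof. by rewrite dotC dotDl !(dotC x). Qed.

Lemma dotZr a x y : dot x (a *: y) = a * dot x y.
Proof. by rewrite dotC dotZl dotC. Qed.

Lemma dotNr x y : dot x (- y) = - dot x y.
Proof. by rewrite dotC dotNl dotC. Qed.

Lemma dotBr x y z : dot x (y - z) = dot x y - dot x z.
Proof. by rewrite dotDr dotNr. Qed.

Lemma dot0l x : dot 0 x = 0.
Proof. by rewrite -(scale0r 0) dotZl mul0r. Qed.

Lemma dot0r x : dot x 0 = 0.
Proof. by rewrite dotC dot0l. Qed.

Lemma dot_suml (I : Type) (r : seq I) (F : I -> 'rV[R]_n) y :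
  dot (\sum_(i <- r) F i) y = \sum_(i <- r) dot (F i) y.
Proof.
elim: r => [|i r IH]; first by rewrite !big_nil dot0l.
by rewrite !big_cons dotDl IH.
Qed.

Lemma dot_ge0 x : 0 <= dot x x.
Proof. by apply: sumr_ge0 => j _; rewrite -expr2 sqr_ge0. Qed.

Lemma norm2_ge0 x : 0 <= norm2 x.
Proof. exact: sqrtr_ge0. Qed.

Lemma norm2_sqr x : norm2 x ^+ 2 = dot x x.
Proof. by rewrite sqr_sqrtr// dot_ge0. Qed.

Lemma norm2_eq0 x : norm2 x = 0 -> x = 0.
Proof.
move=> x0; have : dot x x = 0 by rewrite -norm2_sqr x0 expr0n.
move=> /eqP; rewrite psumr_eq0; last by move=> j _; rewrite -expr2 sqr_ge0.
move=> /allP x00; apply/rowP => j; rewrite mxE.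
by apply/eqP; have := x00 j (mem_index_enum _); rewrite mulf_eq0 orbb.
Qed.

Lemma norm20 : norm2 (0 : 'rV[R]_n) = 0.
Proof. by rewrite /norm2 dot0l sqrtr0. Qed.

Lemma norm2Z a x : norm2 (a *: x) = `|a| * norm2 x.
Proof. by rewrite /norm2 dotZl dotZr mulrA -expr2 sqrtrM ?sqr_ge0// sqrtr_sqr. Qed.

(** Cauchy-Schwarz. With [a], [b] the two norms, the squared norm of [b *: x - a *: y] expands to
    [2 a b (a b - dot x y)]; the factor [a b] cancels once zero vectors are set aside. *)
Lemma dot_le_norm2 x y : dot x y <= norm2 x * norm2 y.
Proof.
have [x0|nx] := eqVneq (norm2 x) 0; first by rewrite (norm2_eq0 x0) dot0l norm20 mul0r.
have [y0|ny] := eqVneq (norm2 y) 0; first by rewrite (norm2_eq0 y0) dot0r norm20 mulr0.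
have ab : 0 < norm2 x * norm2 y by rewrite mulr_gt0// lt_neqAle eq_sym ?nx ?ny norm2_ge0.
have := dot_ge0 (norm2 y *: x - norm2 x *: y).
rewrite !(dotBl, dotBr, dotZl, dotZr) (dotC y x) -!norm2_sqr.
set a := norm2 x in ab *; set b := norm2 y in ab *; set c := dot x y => h.
rewrite -(ler_pM2l ab); move: h.
by rewrite -subr_ge0 => h; rewrite -subr_ge0; nra.
Qed.

(** Cauchy-Schwarz, then AM-GM. The split is made for [c = Lest t]: the second term is the weighted
    squared error, and the first costs at most a quarter of the progress. *)
Lemma dot_young x y c : 0 < c -> dot x y <= c / 4 * norm2 x ^+ 2 + norm2 y ^+ 2 / c.
Proof.
move=> c0; apply: le_trans (dot_le_norm2 x y) _.
rewrite -(ler_pM2l c0) mulrDr (mulrC c (_ / c)) divfK ?gt_eqF//.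
have := sqr_ge0 (c / 2 * norm2 x - norm2 y); nra.
Qed.

End Euclidean.

Section Diameter.
Context {R : realType} {n : nat}.
Implicit Types X : set 'rV[R]_n.

Lemma norm2_le_diam X x y : compact X -> X x -> X y -> norm2 (x - y) <= diam X.
Proof.
move=> cX Xx Xy; apply: sup_upper_bound; last by exists (x, y).
(* [sup] is an upper bound only for a nonempty bounded set. Compactness bounds every coordinate by
   [M + 1], hence every coordinate of a difference by [2 * (M + 1)]. *)
split; first by exists (norm2 (x - y)), (x, y).
have [M [_ MX]] := compact_bounded cX.
have bX z : X z -> forall j, `|z 0 j| <= M + 1.
  move=> Xz j; have /= := MX (M + 1) _ z Xz; rewrite ltrDl ltr01 => /(_ isT).
  by apply: le_trans; rewrite [leRHS]/Num.Def.normr/= mx_normrE; exact: (le_bigmax_cond _ (fun ij => `|z ij.1 ij.2|) (j := (0, j))).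
exists (Num.sqrt (\sum_(j < n) (2 * (M + 1)) ^+ 2)) => _ [[u v] /= [Xu Xv] <-].
rewrite ler_wsqrtr//; apply: ler_sum => j _; rewrite !mxE -expr2.
rewrite -[leLHS]real_normK ?num_real// lerXn2r ?nnegrE//.
  by have := bX _ Xu j; have := normr_ge0 (u 0 j); lra.
rewrite (le_trans (ler_normB _ _))// mulr_natl mulr2n lerD//; exact: bX.
Qed.

Lemma diam_ge0 X : compact X -> X !=set0 -> 0 <= diam X.
Proof.
by move=> cX [x Xx]; apply: le_trans (norm2_le_diam cX Xx Xx); rewrite norm2_ge0.
Qed.

Lemma convex_set_step X x y a : convex_set X -> X x -> X y -> 0 <= a <= 1 ->
  X (x + a *: (y - x)).
Proof.
move=> cX Xx Xy /andP[a0 a1].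
have := cX y x (Itv01 a0 a1) (mem_set Xy) (mem_set Xx).
rewrite inE /conv/= => Xz; rewrite scalerBr addrCA -[X in _ + (X - _)]scale1r -scalerBl; exact: Xz.
Qed.

End Diameter.

(** * Gradients and smoothness *)

Section Gradient.
Context {R : realType} {n : nat}.
Implicit Types (phi : 'rV[R]_n -> R^o) (x v : 'rV[R]_n).

Lemma derive_grad phi x v : differentiable phi x ->
  'D_v phi x = dot (grad phi x) v.
Proof.
move=> dphi; rewrite deriveE// {1}(row_sum_delta v) linear_sum/=.
apply: eq_bigr => j _; rewrite linearZ/= mxE deriveE//.
by rewrite mulrC.
Qed.

(** The quotients along the line and in direction [v] are the same function, so derivability and the
    derivative transfer directly to the restriction of [phi] to a line. *)
Lemma grad_line_increment phi x v (s : R) :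
  (fun h : R => h^-1 *: (((fun t => phi (x + t *: v)) \o shift s) (h *: (1 : R)) - phi (x + s *: v)))
  = (fun h => h^-1 *: ((phi \o shift (x + s *: v)) (h *: v) - phi (x + s *: v))).
Proof.
apply/funext => h /=; congr (_ *: (phi _ - _)).
by rewrite scalerDl /GRing.scale/= mulr1 addrCA.
Qed.

Lemma is_derive_line phi x v (s : R) : differentiable phi (x + s *: v) ->
  is_derive s 1 (fun t : R => phi (x + t *: v)) (dot (grad phi (x + s *: v)) v).
Proof.
move=> dphi; apply: DeriveDef.
  by rewrite /derivable grad_line_increment; exact: diff_derivable.
by rewrite /derive grad_line_increment -derive_grad.
Qed.

(** Subtracting [t a + t^2 c] from [phi] along the segment leaves a function [g] whose derivative is
    at most 0, by Cauchy-Schwarz and the Lipschitz gradient; hence [g 1 <= g 0]. Convexity of [X]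
    keeps the segment where the Lipschitz bound holds. *)
Lemma descent phi (X : set 'rV[R]_n) (L : R) x y : convex_set X ->
  (forall z, differentiable phi z) ->
  (forall z w, X z -> X w -> norm2 (grad phi z - grad phi w) <= L * norm2 (z - w)) ->
  X x -> X y ->
  phi y <= phi x + dot (grad phi x) (y - x) + L / 2 * norm2 (y - x) ^+ 2.
Proof.
move=> cX dphi Lphi Xx Xy; set v := y - x.
pose a := dot (grad phi x) v; pose c := L / 2 * norm2 v ^+ 2.
pose g t : R := phi (x + t *: v) - (t * a + t ^+ 2 * c).
have dg (t : R) : is_derive t 1 g (dot (grad phi (x + t *: v)) v - (a + 2 * t * c)).
  have dp := is_derive_line (dphi (x + t *: v)).
  have dq : is_derive t 1 (fun u : R => u * a + u ^+ 2 * c) (a + 2 * t * c).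
    apply: is_derive_eq.
    by rewrite /GRing.scale/=; ring.
  exact: is_deriveB.
have g1_le0 (t : R) : t \in `]0, 1[%R -> derive1 g t <= 0.
  rewrite in_itv/= => /andP[t0 t1]; rewrite derive1E derive_val.
  have Xt : X (x + t *: v) by apply: convex_set_step; rewrite // !ltW.
  have := le_trans (dot_le_norm2 (grad phi (x + t *: v) - grad phi x) v)
    (ler_wpM2r (norm2_ge0 v) (Lphi _ _ Xt Xx)).
  rewrite dotBl addrAC subrr add0r norm2Z (ger0_norm (ltW t0)) /c => h.
  by rewrite /a /c; nra.
have dg1 t : derivable g t 1 by case: (dg t).
have cg : {within `[0, 1], continuous g}.
  by apply: derivable_within_continuous => t _; exact: dg1.
have : g 1 <= g 0.
  apply: (ler0_derive1_le_cc (fun t _ => dg1 t) g1_le0 cg);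
    by rewrite ?in_itv/= ?lexx ?ler01.
rewrite /g scale1r scale0r addr0 /v [x + _]addrC subrK -/v; rewrite /a /c; lra.
Qed.

End Gradient.

(** * Borel measurability in R^n *)

Section Measurability.
Context {R : realType} {n : nat} {d : measure_display} {T : measurableType d}.
Implicit Types (x : T -> 'rV[R]_n) (phi : 'rV[R]_n -> R^o).

Definition measurable_coord x := forall j, measurable_fun setT (fun w => x w 0 j).

(** Boxes with rational centre and radius [1/(k+1)] are countably many, an open set is the union of
    those it contains, and the preimage of a box is a finite intersection of coordinate
    conditions. *)
Lemma measurable_preimage_open x (A : set 'rV[R]_n) :
  measurable_coord x -> open A -> measurable (x @^-1` A).
Proof.
move=> mx oA.
pose box (q : 'rV[rat]_n) (k : nat) : set 'rV[R]_n :=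
  [set z | forall j, `|ratr (q 0 j) - z 0 j| < k.+1%:R^-1].
pose F (u : 'rV[rat]_n * nat) : set T :=
  if pselect (box u.1 u.2 `<=` A) then x @^-1` box u.1 u.2 else set0.
have -> : x @^-1` A = \bigcup_u F u.
  apply/seteqP; split=> [w Aw|w [[q k]] _]; last first.
    by rewrite /F/=; case: pselect => [sA /sA|].
  have /nbhs_ballP[e /= e0 eA] := open_nbhs_nbhs (conj oA Aw).
  (* A radius below [e / 2] keeps every box that contains [x w] within distance [e] of it. *)
  have [k ke] : exists k : nat, k.+1%:R^-1 < e / 2.
    have [k _ hk] := (near_infty_natSinv_lt (PosNum (divr_gt0 e0 (ltr0n _ 2)))).
    by exists k; exact: (hk k (leqnn k)).
  have /choice[q hq] : forall j, exists r : rat, `|ratr r - x w 0 j| < k.+1%:R^-1.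
    move=> j; have k0 : (0 : R) < k.+1%:R^-1 by rewrite invr_gt0 ltr0n.
    have [r] : exists r : rat, (ratr r : R) \in `]x w 0 j - k.+1%:R^-1, x w 0 j + k.+1%:R^-1[.
      by apply: rat_in_itvoo; rewrite ltrD2l gtrN.
    by rewrite in_itv/= => hr; exists r; rewrite ltr_distl.
  have bw : box (\row_j q j) k (x w) by move=> j; rewrite mxE.
  exists (\row_j q j, k) => //; rewrite /F/=; case: pselect => // -[] z bz; apply: eA.
  split=> // i j; rewrite (ord1 i) /ball/= /ball_/=.
  move: ke (bz j) (bw j) => /=; set c := (k.+1%:R^-1 : R) => ke bz' bw'.
  rewrite distrC in bw'.
  by rewrite -(subrK (ratr ((\row_j q j) 0 j)) (x w 0 j)) -addrA (le_lt_trans (ler_normD _ _))//; lra.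
apply: countable_bigcupT_measurable => [|[q k]]; first exact: countableP.
 rewrite /F/=; case: pselect => [?|?] //=.
have -> : x @^-1` box q k = \big[setI/setT]_(j < n) [set w | `|ratr (q 0 j) - x w 0 j| < k.+1%:R^-1].
  by rewrite -bigcap_seq; apply/seteqP; split=> w h; [move=> j _; exact: h|move=> j; apply: h; rewrite /= mem_index_enum].
apply: bigsetI_measurable => j _.
rewrite (_ : [set _ | _] = setT `&` (fun w => ratr (q 0 j) - x w 0 j) @^-1` ball 0 (k.+1%:R^-1)); last first.
  by rewrite setTI; apply/seteqP; split=> w; rewrite /ball/= /ball_/= sub0r normrN.
by apply: measurable_funB => //; exact: measurable_ball.
Qed.

Lemma measurable_continuous_coord x phi : measurable_coord x -> continuous phi ->
  measurable_fun setT (fun w => phi (x w) : R).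
Proof.
move=> mx /continuousP cphi; apply: (measurability _ (RGenOpens.measurableE R)).
move=> _ [_ [a [b ->] <-]]; rewrite setTI.
by apply: (measurable_preimage_open mx (A := phi @^-1` `]a, b[%classic)); exact/cphi/interval_open.
Qed.

(** Differentiability does not make [grad phi] continuous; each partial derivative is instead a
    pointwise limit of the measurable difference quotients with step [1/(k+1)]. *)
Lemma measurable_grad_coord x phi : measurable_coord x ->
  (forall z, differentiable phi z) -> measurable_coord (fun w => grad phi (x w)).
Proof.
move=> mx dphi j.
have cphi : continuous phi by move=> z; exact: differentiable_continuous.
have m0 : measurable_fun setT (fun w => phi (x w) : R) by exact: measurable_continuous_coord.
apply: (measurable_fun_cvg (h := fun k w => k.+1%:R *
   ((phi (k.+1%:R^-1 *: delta_mx 0 j + x w) : R) - (phi (x w) : R)))).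
  move=> k; apply: measurable_funM => //; apply: measurable_funB => //.
  apply: (@measurable_continuous_coord (fun w => k.+1%:R^-1 *: delta_mx 0 j + x w)) => // i.
  by under eq_fun do rewrite !mxE; apply: measurable_funD.
move=> w _; rewrite mxE.
have /cvg_ex[l hl] := diff_derivable (v := delta_mx 0 j) (dphi (x w)).
rewrite /derive (cvg_lim _ hl)//.
(* The derivative is a limit over nonzero increments, so the steps must converge in the punctured
   filter at 0. *)
have c0 : (k.+1%:R^-1 : R) @[k --> \oo] --> (0 : R)^'.
  move=> A /= A0.
  have [m _ hm] : \forall k \near \oo, @harmonic R k != 0 -> A (harmonic k).
    exact: (@cvg_harmonic R _ A0).
  by exists m => // k mk; apply: hm => //; rewrite /harmonic invr_eq0 pnatr_eq0.
have := cvg_comp _ _ c0 hl; apply: cvg_trans.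
by apply: near_eq_cvg; near=> k; rewrite /= invrK.
Unshelve. all: by end_near.
Qed.

Lemma measurable_sqrtr (f : T -> R) :
  measurable_fun setT f -> measurable_fun setT (fun w => Num.sqrt (f w)).
Proof.
move=> mf; apply: (measurableT_comp _ mf).
by apply: continuous_measurable_fun => z; exact: sqrt_continuous.
Qed.

Lemma measurable_invr (f : T -> R) :
  (forall w, 0 < f w) -> measurable_fun setT f ->
  measurable_fun setT (fun w => (f w)^-1).
Proof.
move=> f0 mf; rewrite (_ : (fun w => _) = fun w => expR (- ln (f w))); last first.
  by apply/funext => w; rewrite expRN lnK// posrE.
have mln : measurable_fun setT (fun w => - ln (f w)).
  by apply: measurable_funN; apply: (measurableT_comp _ mf); exact: measurable_ln.
by apply: (measurableT_comp _ mln); exact: measurable_expR.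
Qed.

Lemma measurable_dot (y z : T -> 'rV[R]_n) :
  measurable_coord y -> measurable_coord z -> measurable_fun setT (fun w => dot (y w) (z w)).
Proof. by move=> my mz; apply: measurable_sum => j; exact: measurable_funM. Qed.

Lemma measurable_coordD (y z : T -> 'rV[R]_n) :
  measurable_coord y -> measurable_coord z -> measurable_coord (fun w => y w + z w).
Proof. by move=> my mz j; under eq_fun do rewrite mxE; exact: measurable_funD. Qed.

Lemma measurable_coordZ (c : R) (y : T -> 'rV[R]_n) :
  measurable_coord y -> measurable_coord (fun w => c *: y w).
Proof. by move=> my j; under eq_fun do rewrite mxE; exact: measurable_funM. Qed.

Lemma measurable_coordB (y z : T -> 'rV[R]_n) :
  measurable_coord y -> measurable_coord z -> measurable_coord (fun w => y w - z w).
Proof.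
by move=> my mz j; under eq_fun do rewrite !mxE; exact: measurable_funB.
Qed.

Lemma measurable_coord_sum (I : Type) (r : seq I)
    (y : I -> T -> 'rV[R]_n) :
  (forall i, measurable_coord (y i)) -> measurable_coord (fun w => \sum_(i <- r) y i w).
Proof.
by move=> my j; under eq_fun do rewrite summxE; apply: measurable_sum => i; exact: my.
Qed.

Lemma measurable_norm2_sqr (y : T -> 'rV[R]_n) :
  measurable_coord y -> measurable_fun setT (fun w => norm2 (y w) ^+ 2).
Proof. by move=> my; under eq_fun do rewrite norm2_sqr; exact: measurable_dot. Qed.

End Measurability.

(** * Independence and mini-batch averages *)

Section Independence.
Context {R : realType} {d : measure_display} {T : measurableType d}.
Local Open Scope ereal_scope.

(** [mu] is the sum of its restrictions to [E] and to the complement; [f \_ E] equals [f] almost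
    everywhere for the first and 0 almost everywhere for the second. *)
Lemma ge0_integral_mrestr (mu : {measure set T -> \bar R}) (E : set T)
    (mE : measurable E) (f : T -> \bar R) :
  measurable_fun setT f -> (forall w, 0 <= f w) ->
  \int[mrestr mu mE]_w f w = \int[mu]_(w in E) f w.
Proof.
move=> mf f0.
have mEc : measurable (~` E) by exact: measurableC.
have mfE : measurable_fun setT (f \_ E).
  by apply/(measurable_restrictT _ mE); exact: measurable_funTS.
have fE0 w : 0 <= (f \_ E) w by rewrite patchE; case: ifP.
rewrite [RHS]integral_mkcond.
rewrite (eq_measure_integral (measure_add (mrestr mu mE) (mrestr mu mEc))); last first.
  move=> A mA _; rewrite -[RHS]/(measure_add _ _ A) (measure_addE (mrestr mu mE) (mrestr mu mEc)).
  rewrite /= /mrestr -measureU//.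
  - by rewrite -setIUr setUv setIT.
  - exact: measurableI.
  - exact: measurableI.
  - by rewrite setIACA setICr setI0.
rewrite ge0_integral_measure_add//.
rewrite (ge0_ae_eq_integral (mu := mrestr mu mE) (g := f \_ E) measurableT mf mfE)//; last first.
  exists (~` E); split => //; first by rewrite /= /mrestr setICl measure0.
  by move=> w /= nf Ew; apply: nf => _; rewrite patchE mem_set.
rewrite (ge0_ae_eq_integral (mu := mrestr mu mEc) (g := cst 0) measurableT mfE)//.
  by rewrite integral0 adde0.
exists E; split => //; first by rewrite /= /mrestr setICr measure0.
by move=> w /= nf; apply: contrapT => Ew; apply: nf => _; rewrite patchE memNset.
Qed.

Lemma ge0_integral_proportional d' (T' : measurableType d')
    (m1 m2 : {measure set T' -> \bar R}) (c : R) (f : T' -> \bar R) :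
  (0 <= c)%R -> (forall A, measurable A -> m1 A = c%:E * m2 A) ->
  measurable_fun setT f -> (forall w, 0 <= f w) ->
  \int[m1]_w f w = c%:E * \int[m2]_w f w.
Proof.
move=> c0 m12 mf f0.
rewrite -[c]/((NngNum c0)%:num) -ge0_integral_mscale//.
by apply: eq_measure_integral => A mA _; rewrite /= /mscale/= m12.
Qed.

(** [f] is measurable for the sigma-algebra generated by [G]. Pushed forward to that sigma-algebra,
    the restriction of [P] to [E] is [P E] times [P] by independence, so the two integrals are
    proportional. *)
Lemma ge0_integral_independent (P : probability T R) (G : set (set T)) (E : set T)
    (f : g_sigma_algebraType G -> \bar R) :
  G `<=` measurable -> measurable E ->
  (forall A, <<s G >> A -> P (A `&` E) = P A * P E) ->
  measurable_fun setT f -> (forall w, 0 <= f w) ->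
  \int[P]_(w in E) f w = P E * \int[P]_w f w.
Proof.
move=> GM mE indep mf f0.
have GM' : <<s G >> `<=` (measurable : set (set T)).
  by apply: smallest_sub => //; exact: sigma_algebra_measurable.
have mid : measurable_fun [set: T] (idfun : T -> g_sigma_algebraType G).
  by move=> _ A mA; rewrite setTI; exact: GM'.
have mfT : measurable_fun [set: T] (f : T -> \bar R) by exact: (measurableT_comp mf mid).
rewrite -(ge0_integral_mrestr P mE mfT f0).
have push (m : {measure set T -> \bar R}) :=
  ge0_integral_pushforward mid m measurableT mf (fun w _ => f0 w).
rewrite /= preimage_setT in push; rewrite -!push.
have PE : P E \is a fin_num by exact: fin_num_measure.
rewrite -[P E]fineK//; apply: ge0_integral_proportional => // [|A mA].
  exact: fine_ge0.
by rewrite /= /pushforward /mrestr /= fineK// indep// muleC.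
Qed.

End Independence.

Section BatchAverage.
Context {R : realType} {N : nat}.

Lemma big_tuple_cons (b : nat) (F : b.+1.-tuple 'I_N -> R) :
  \sum_u F u = \sum_(i < N) \sum_(u : b.-tuple 'I_N) F [tuple of i :: u].
Proof.
rewrite pair_big/=.
rewrite (reindex (fun z : 'I_N * b.-tuple 'I_N => [tuple of z.1 :: z.2]))//=.
exists (fun u : b.+1.-tuple 'I_N => (thead u, [tuple of behead u])).
  by move=> [i u] _ /=; rewrite theadE; congr pair; apply/val_inj.
by move=> u _ /=; rewrite -tuple_eta.
Qed.

(* The average over all tuples is the expectation over a uniform batch; the cross terms
   vanish because [c] is centered. *)
Lemma batch_second_moment (b : nat) (c : 'I_N -> R) (a : R) : (0 < N)%N ->
  \sum_i c i = 0 ->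
  N%:R^-1 ^+ b * \sum_(u : b.-tuple 'I_N) (a + \sum_(j < b) c (tnth u j)) ^+ 2
  = a ^+ 2 + b%:R * (N%:R^-1 * \sum_i c i ^+ 2).
Proof.
move=> N0 c0; have nN : (N%:R : R) != 0 by rewrite pnatr_eq0 -lt0n.
elim: b a => [|b IH] a.
  rewrite (big_pred1 [tuple]); last by move=> u; apply/esym/eqP/tuple0.
  by rewrite big_ord0 expr0 mul1r addr0 mul0r addr0.
(* The first index of the tuple joins the offset, so the induction hypothesis is used at
   [a + c i]. *)
rewrite big_tuple_cons exprS -mulrA mulr_sumr.
under eq_bigr => i _.
  under eq_bigr => u _.
    rewrite big_ord_recl tnth0 addrA.
    under eq_bigr => j _ do rewrite tnthS.
    over.
  rewrite IH sqrrD.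
  over.
have ac0 : \sum_i a * c i = 0 by rewrite -mulr_sumr c0 mulr0.
have cst (x : R) : \sum_(i < N) x = N%:R * x by rewrite sumr_const card_ord mulr_natl.
rewrite !big_split/= ac0 !addr0 !cst.
by rewrite -[in RHS](addn1 b) natrD; field.
Qed.

End BatchAverage.

(** * The finite-sum objective *)

Section Objective.
Context {R : realType} {n N : nat} {p : problem R n N}.
Context (Hp : standing_assumptions p).
Implicit Types x y v : 'rV[R]_n.

Lemma kappa_ge1 rho : 0 < rho -> 1 <= kappa p rho.
Proof.
move=> rho0; rewrite /kappa lerDl mulr_ge0 ?(ltW rho0)// diam_ge0//; first exact: X_compact.
by have [x Xx _] := dom_meets_X Hp; exists x.
Qed.

Lemma reg_fin_num x : (reg p x < +oo)%E -> reg p x \is a fin_num.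
Proof.
move=> hy; have [hN _] := h_proper Hp.
by rewrite fin_numE hN/= lt_eqF.
Qed.

Lemma dot_grad_favg x v :
  dot (grad (favg p) x) v = N%:R^-1 * \sum_(i < N) dot (grad (component p i) x) v.
Proof.
rewrite -dot_suml -dotZl; congr dot; apply/rowP => j.
rewrite !mxE summxE.
have df i : derivable (component p i : 'rV[R]_n -> R^o) x (delta_mx 0 j).
  exact/diff_derivable/f_differentiable.
rewrite (_ : favg p = N%:R^-1 \*: (\sum_(i < N) (component p i : 'rV[R]_n -> R^o))).
  rewrite deriveZ; last exact: derivable_sum.
  by rewrite derive_sum//; congr (_ * _); apply: eq_bigr => i _; rewrite mxE.
by apply/funext => y; rewrite /favg/= fct_sumE.
Qed.

Lemma grad_favg x : grad (favg p) x = N%:R^-1 *: \sum_(i < N) grad (component p i) x.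
Proof.
apply/rowP => j; have := dot_grad_favg x (delta_mx 0 j).
have pick (z : 'rV[R]_n) : dot z (delta_mx 0 j) = z 0 j.
  rewrite /dot (bigD1 j)//= big1 => [|i ij]; rewrite mxE ?eqxx ?mulr1 ?addr0//.
  by rewrite (negbTE ij) andbF mulr0.
by rewrite pick !mxE summxE => ->; congr (_ * _); apply: eq_bigr => i _; rewrite pick.
Qed.

Lemma descent_favg x y : feasible p x -> feasible p y ->
  favg p y <= favg p x + dot (grad (favg p) x) (y - x)
              + smooth p / 2 * norm2 (y - x) ^+ 2.
Proof.
move=> Xx Xy; have N0 := N_gt0 Hp.
have nN : (N%:R : R) != 0 by rewrite pnatr_eq0 -lt0n.
rewrite dot_grad_favg /favg.
have -> : smooth p / 2 * norm2 (y - x) ^+ 2 =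
    N%:R^-1 * \sum_(i < N) (smooth p / 2 * norm2 (y - x) ^+ 2).
  by rewrite sumr_const card_ord mulrnAr -mulrnAl -[N%:R^-1 *+ N]mulr_natr mulVf ?mul1r.
rewrite -!mulrDr -!big_split/= ler_wpM2l ?invr_ge0//.
apply: ler_sum => i _.
apply: (@descent _ _ (component p i) (feasible p)) => //.
- exact: X_convex.
- exact: f_differentiable.
- exact: f_smooth.
Qed.

End Objective.

(** * Inequalities along a trajectory *)

Section Trajectory.
Context {R : realType} {n N b : nat} {d : measure_display} {Omega : measurableType d}.
Context (P : probability Omega R) (p : problem R n N) (rho : R) (q : nat)
  (x0 : 'rV[R]_n) (s : process R n N b d Omega).
Context (Hp : standing_assumptions p) (rho_gt0 : 0 < rho)
  (Xx0 : feasible p x0) (hx0 : (reg p x0 < +oo)%E) (Hs : alfcg_fs P p rho q x0 s).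
Local Notation D := (diam (feasible p)).
Local Notation L := (smooth p).
Local Notation X := (feasible p).
Local Notation x := (iterate s).
Local Notation v := (lmo s).
Local Notation g := (gest s).
Local Notation Lt := (Lest s).

Definition move t w : R := norm2 (x t.+1 w - x t w).
Definition err t w : 'rV[R]_n := grad (favg p) (x t w) - g t w.
(** The Frank-Wolfe gap with [g t] in place of the true gradient, attained at [v t]; it is also the
    numerator of the step size. Both [fine] values are genuine, since [reg p] is finite along a
    trajectory. *)
Definition est_gap t w : R :=
  fine (reg p (x t w)) - fine (reg p (v t w)) - dot (g t w) (v t w - x t w).
Definition eta t w : R := step_size p (Lt t w) (g t w) (v t w) (x t w).
Definition value t w : R := favg p (x t w) + fine (reg p (x t w)).

Lemma Lest_ge t w : rho <= Lt t w.
Proof.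
rewrite (Lest_rule Hs) ler_peMr ?(ltW rho_gt0)//.
rewrite -[leLHS]sqrtr1 ler_wsqrtr// lerDl sumr_ge0// => i _.
by rewrite mulr_ge0// sqr_ge0.
Qed.

Lemma Lest_gt0 t w : 0 < Lt t w.
Proof. exact: lt_le_trans (Lest_ge t w). Qed.

Lemma Lest0 w : Lt 0 w = rho.
Proof. by rewrite (Lest_rule Hs) big_ord0 addr0 sqrtr1 mulr1. Qed.

(** Squaring the rule turns its growing sum into a one-step product, which yields both the
    monotonicity of [Lest] and the logarithmic bound on the moves. *)
Lemma Lest_recE t w :
  Lt t.+1 w ^+ 2 = Lt t w ^+ 2 * (1 + rho ^+ 2 * move t w ^+ 2).
Proof.
have sqE u : Lt u w ^+ 2 = rho ^+ 2 *
    (1 + \sum_(i < u) Lt i w ^+ 2 * norm2 (x i.+1 w - x i w) ^+ 2).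
  rewrite (Lest_rule Hs) exprMn sqr_sqrtr// addr_ge0// sumr_ge0// => i _.
  by rewrite mulr_ge0// sqr_ge0.
rewrite [LHS]sqE big_ord_recr/= -/(move t w) addrA mulrDr -sqE; ring.
Qed.

Lemma Lest_homo w : {homo (fun t => Lt t w) : i j / (i <= j)%N >-> i <= j}.
Proof.
apply: homo_leq => [//|i j k|t]; first exact: le_trans.
rewrite -(@ler_pXn2r _ 2)// ?nnegrE ?(ltW (Lest_gt0 _ _))// Lest_recE ler_peMr ?sqr_ge0//.
by rewrite lerDl mulr_ge0// sqr_ge0.
Qed.

(** This is [sqrt (1 + u) <= 1 + u / 2] at [u = rho^2 move^2], checked on squares. *)
Lemma Lest_step t w : Lt t.+1 w <= Lt t w + rho ^+ 2 / 2 * (Lt t w * move t w ^+ 2).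
Proof.
have L0 := ltW (Lest_gt0 t w); have m0 := sqr_ge0 (move t w); have r0 := sqr_ge0 rho.
have b0 : 0 <= rho ^+ 2 / 2 * (Lt t w * move t w ^+ 2) by apply: mulr_ge0; [apply: divr_ge0|apply: mulr_ge0].
rewrite -(@ler_pXn2r _ 2)//; last 2 first.
- by rewrite nnegrE ltW// Lest_gt0.
- by rewrite nnegrE addr_ge0.
rewrite Lest_recE; have := sqr_ge0 (rho ^+ 2 / 2 * (Lt t w * move t w ^+ 2)); lra.
Qed.

Lemma step_quotient t w : eta t w =
  Num.min (fine (reg p (x t w) - reg p (v t w) - (dot (g t w) (v t w - x t w))%:E)%E
           / (Lt t w * norm2 (v t w - x t w) ^+ 2)) 1.
Proof. by []. Qed.

Lemma reg_lmo_lty t w : (reg p (v t w) < +oo)%E.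
Proof.
have := lmo_argmin Hs t w Xx0; rewrite -(fineK (reg_fin_num Hp hx0)) -EFinD.
move=> /le_lt_trans/(_ (ltry _)); have [hN _] := h_proper Hp.
by case: (reg p (v t w)) (hN (v t w)) => [r||] // _; rewrite ?ltry.
Qed.

(** Feasibility and finiteness at time [t] are hypotheses here because the induction that
    establishes them, [iterate_dom], itself needs [eta] in [[0, 1]]. *)
Lemma eta_itv_aux t w : X (x t w) -> (reg p (x t w) < +oo)%E ->
  [/\ 0 <= est_gap t w, 0 <= eta t w <= 1 &
    eta t w = Num.min (est_gap t w / (Lt t w * norm2 (v t w - x t w) ^+ 2)) 1].
Proof.
move=> Xx hx; have gap0 : 0 <= est_gap t w.
  have := lmo_argmin Hs t w Xx.
  rewrite -(fineK (reg_fin_num Hp hx)) -(fineK (reg_fin_num Hp (reg_lmo_lty t w))).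
  by rewrite -!EFinD lee_fin /est_gap dotBr ![dot (g t w) _]dotC; lra.
have etaE : eta t w = Num.min (est_gap t w / (Lt t w * norm2 (v t w - x t w) ^+ 2)) 1.
  rewrite step_quotient /est_gap.
  by rewrite -(fineK (reg_fin_num Hp hx)) -(fineK (reg_fin_num Hp (reg_lmo_lty t w))).
split => //; rewrite etaE ge_min lexx orbT andbT le_min ler01 andbT.
by rewrite divr_ge0// mulr_ge0 ?sqr_ge0// ltW// Lest_gt0.
Qed.

Lemma iterate_dom t w : X (x t w) /\ (reg p (x t w) < +oo)%E.
Proof.
elim: t => [|t [Xx hx]]; first by rewrite (iterate0 Hs).
have [_ e01 _] := eta_itv_aux Xx hx.
rewrite (iterate_rule Hs) -/(eta t w); split.
  by apply: convex_set_step => //; [exact: X_convex|exact: lmo_feasible Hs _ _].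
have := h_convex Hp (v t w) (x t w) e01.
rewrite -(fineK (reg_fin_num Hp hx)) -(fineK (reg_fin_num Hp (reg_lmo_lty t w))).
rewrite -!EFinM -EFinD => /le_lt_trans/(_ (ltry _)).
by rewrite scalerBl scale1r scalerBr [_ + (x t w - _)]addrCA.
Qed.

Let Xx t w : X (x t w). Proof. by case: (iterate_dom t w). Qed.
Let hx t w : (reg p (x t w) < +oo)%E. Proof. by case: (iterate_dom t w). Qed.
Let Xv t w : X (v t w). Proof. exact: lmo_feasible Hs _ _. Qed.

Lemma reg_iterateE t w : reg p (x t w) = (fine (reg p (x t w)))%:E.
Proof. by rewrite fineK// reg_fin_num. Qed.

Lemma reg_lmoE t w : reg p (v t w) = (fine (reg p (v t w)))%:E.
Proof. by rewrite fineK// reg_fin_num// reg_lmo_lty. Qed.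

Lemma est_gap_ge0 t w : 0 <= est_gap t w.
Proof. by have [] := eta_itv_aux (Xx t w) (hx t w). Qed.

Lemma eta_itv t w : 0 <= eta t w <= 1.
Proof. by have [] := eta_itv_aux (Xx t w) (hx t w). Qed.

Lemma etaE t w :
  eta t w = Num.min (est_gap t w / (Lt t w * norm2 (v t w - x t w) ^+ 2)) 1.
Proof. by have [] := eta_itv_aux (Xx t w) (hx t w). Qed.

Lemma iterate_diff t w : x t.+1 w - x t w = eta t w *: (v t w - x t w).
Proof. by rewrite (iterate_rule Hs) addrAC subrr add0r. Qed.

Lemma moveE t w : move t w = eta t w * norm2 (v t w - x t w).
Proof.
by rewrite /move iterate_diff norm2Z ger0_norm//; case/andP: (eta_itv t w).
Qed.

Lemma move_ge0 t w : 0 <= move t w.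
Proof. exact: norm2_ge0. Qed.

Lemma move_le_diam t w : move t w <= D.
Proof. by apply: norm2_le_diam => //; exact: X_compact. Qed.

Lemma lmo_dist_le_diam t w : norm2 (v t w - x t w) <= D.
Proof. by apply: norm2_le_diam => //; exact: X_compact. Qed.

(** The step size never exceeds the quotient, so [eta * Lt * z^2 <= est_gap]; multiplying by [eta]
    produces [move^2] on the left. At [z = 0] the left side vanishes. *)
Lemma Lest_move_le t w : Lt t w * move t w ^+ 2 <= eta t w * est_gap t w.
Proof.
rewrite moveE; set z := norm2 _; have /andP[e0 _] := eta_itv t w.
have [z0|nz] := eqVneq z 0.
  by rewrite z0 mulr0 expr0n mulr0 mulr_ge0// est_gap_ge0.
have Lz : 0 < Lt t w * z ^+ 2 by rewrite mulr_gt0 ?Lest_gt0// exprn_even_gt0.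
have : eta t w <= est_gap t w / (Lt t w * z ^+ 2) by rewrite etaE ge_min lexx.
rewrite ler_pdivlMr// => h; have := ler_wpM2l e0 h; lra.
Qed.

(* When the step is not truncated, [eta = gap / (L z^2)], so [gap^2 = (eta gap) L z^2]
   and the bound is AM-GM with weight [S]. *)
Lemma est_gap_le t w (S : R) : 0 < S ->
  est_gap t w <= (1 + S / 2) * (eta t w * est_gap t w) + D ^+ 2 * Lt t w / (2 * S).
Proof.
move=> S0; have g0 := est_gap_ge0 t w; have L0 := Lest_gt0 t w.
have D0 : 0 <= D ^+ 2 * Lt t w / (2 * S).
  by apply: divr_ge0; apply: mulr_ge0 => //; [exact: sqr_ge0|exact: ltW|exact: ltW].
have /andP[e0 _] := eta_itv t w.
have m0 : 0 <= S / 2 * (eta t w * est_gap t w) by apply: mulr_ge0; [apply: divr_ge0 => //; exact: ltW|exact: mulr_ge0].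
rewrite mulrDl mul1r.
move: (etaE t w); set z := norm2 _; rewrite minEle; case: ifP => [_ eE|_ ->]; last first.
  (* A truncated step has [eta = 1], so the progress term alone covers the gap. *)
  by rewrite mul1r; have := mulr_ge0 (ltW S0) g0; lra.
have [z0|nz] := eqVneq z 0.
  have v_x : v t w - x t w = 0 by exact: norm2_eq0 z0.
  have : est_gap t w = 0.
    by rewrite /est_gap v_x dot0r subr0 (subr0_eq v_x) subrr.
  by move=> ->; rewrite !mulr0; lra.
have zD : z ^+ 2 <= D ^+ 2.
  rewrite lerXn2r ?nnegrE ?norm2_ge0// ?lmo_dist_le_diam//.
  by rewrite (le_trans (norm2_ge0 _) (lmo_dist_le_diam t w)).
have Lz : 0 < Lt t w * z ^+ 2 by rewrite mulr_gt0// exprn_even_gt0.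
have gE : est_gap t w = eta t w * (Lt t w * z ^+ 2) by rewrite eE divfK ?gt_eqF.
have h1 : est_gap t w <= S / 2 * (eta t w * est_gap t w) + z ^+ 2 * Lt t w / (2 * S).
  have S2 : 0 < 2 * S by rewrite mulr_gt0.
  rewrite -(ler_pM2l S2).
  have -> : 2 * S * (S / 2 * (eta t w * est_gap t w) + z ^+ 2 * Lt t w / (2 * S))
      = S ^+ 2 * (eta t w * est_gap t w) + z ^+ 2 * Lt t w by field; rewrite gt_eqF.
  have := mulr_ge0 (ltW Lz) (sqr_ge0 (S * eta t w - 1)).
  rewrite gE; lra.
have h2 : z ^+ 2 * Lt t w / (2 * S) <= D ^+ 2 * Lt t w / (2 * S).
  by rewrite ler_wpM2r ?invr_ge0 ?pmulr_rge0 ?(ltW S0)// ler_wpM2r// ltW.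
have := mulr_ge0 e0 g0; lra.
Qed.

(** Convexity bounds [h] at the new iterate and the descent lemma bounds [f]. Splitting the gradient
    as [g + err], the [g] part combines with the [h] part into [- eta * est_gap]. *)
Lemma value_descent t w : value t.+1 w + eta t w * est_gap t w
  <= value t w + dot (err t w) (x t.+1 w - x t w) + L / 2 * move t w ^+ 2.
Proof.
have hc : fine (reg p (x t.+1 w)) <=
    eta t w * fine (reg p (v t w)) + (1 - eta t w) * fine (reg p (x t w)).
  have := h_convex Hp (v t w) (x t w) (eta_itv t w).
  rewrite (_ : _ *: _ + _ = x t.+1 w); last first.
    by rewrite (iterate_rule Hs) -/(eta t w) scalerBl scale1r scalerBr addrCA.
  by rewrite (reg_iterateE t.+1) (reg_iterateE t) reg_lmoE -!EFinM -EFinD lee_fin.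
have := descent_favg Hp (Xx t w) (Xx t.+1 w); rewrite -/(move t w).
have gE : dot (g t w) (x t.+1 w - x t w) = eta t w * dot (g t w) (v t w - x t w).
  by rewrite iterate_diff dotZr.
rewrite /value /err /est_gap dotBl gE; lra.
Qed.

Lemma optval_le_value t w : fine (optval p) <= value t w.
Proof.
rewrite -lee_fin fineK ?optval_finite// /value EFinD -reg_iterateE.
by apply: ereal_inf_lbound; exists (x t w).
Qed.

Lemma sum_progress_le T w :
  \sum_(t < T) eta t w * est_gap t w
  <= 4 / 3 * (fine (objective p x0) - fine (optval p)
     + \sum_(t < T) norm2 (err t w) ^+ 2 / Lt t w
     + L / 2 * \sum_(t < T) move t w ^+ 2).
Proof.
(* Young's inequality with weight [Lest t] costs [Lt / 4 * move^2], at most a quarter of the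
   progress; the remaining 3/4 explains the factor 4/3. *)
have step t : value t.+1 w + 3 / 4 * (eta t w * est_gap t w)
    <= value t w + norm2 (err t w) ^+ 2 / Lt t w + L / 2 * move t w ^+ 2.
  have := value_descent t w; have := Lest_move_le t w.
  have := dot_young (x t.+1 w - x t w) (err t w) (Lest_gt0 t w).
  by rewrite -/(move t w) dotC; lra.
have tele : value T w + 3 / 4 * \sum_(t < T) eta t w * est_gap t w
    <= value 0 w + \sum_(t < T) norm2 (err t w) ^+ 2 / Lt t w
       + L / 2 * \sum_(t < T) move t w ^+ 2.
  elim: T => [|T IH]; first by rewrite !big_ord0 !mulr0 !addr0.
  by rewrite !big_ord_recr/=; have := step T; lra.
have -> : fine (objective p x0) = value 0 w.
  by rewrite /objective /value (iterate0 Hs) -(fineK (reg_fin_num Hp hx0)).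
have := optval_le_value T w; lra.
Qed.

Lemma Lest_le_progress T w :
  Lt T w <= rho + rho ^+ 2 / 2 * \sum_(t < T) eta t w * est_gap t w.
Proof.
elim: T => [|T IH]; first by rewrite Lest0 big_ord0 mulr0 addr0.
rewrite big_ord_recr/=; have r0 : 0 <= rho ^+ 2 / 2 by rewrite divr_ge0 ?sqr_ge0.
have := ler_wpM2l r0 (Lest_move_le T w); have := Lest_step T w; lra.
Qed.

(* [ln (1 + y) >= y / (1 + y)] at [y = rho^2 move^2], where [1 + y <= kappa^2]. *)
Lemma move_le_ln t w :
  move t w ^+ 2 <= 2 * kappa p rho ^+ 2 / rho ^+ 2 * (ln (Lt t.+1 w) - ln (Lt t w)).
Proof.
set y := rho ^+ 2 * move t w ^+ 2.
have y0 : 0 <= y by apply: mulr_ge0; exact: sqr_ge0.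
have y1 : 0 < 1 + y by rewrite ltr_wpDr.
have k1 := kappa_ge1 Hp rho_gt0.
have k0 : 0 < kappa p rho ^+ 2 by rewrite exprn_gt0// (lt_le_trans _ k1).
have r0 : 0 < rho ^+ 2 by rewrite exprn_gt0.
have yk : 1 + y <= kappa p rho ^+ 2.
  have rm : rho * move t w <= rho * D by rewrite ler_pM2l// move_le_diam.
  have rm0 : 0 <= rho * move t w by apply: mulr_ge0; [exact: ltW|exact: move_ge0].
  by rewrite /y /kappa -exprMn; nra.
have lnE : ln (1 + y) = 2 * (ln (Lt t.+1 w) - ln (Lt t w)).
  have : ln (Lt t.+1 w ^+ 2) = ln (Lt t w ^+ 2 * (1 + y)) by rewrite Lest_recE.
  rewrite lnM ?posrE ?exprn_gt0 ?Lest_gt0// !lnXn ?Lest_gt0// !mulr2n; lra.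
(* This is [ln u <= u - 1] at [u = 1 / (1 + y)], with signs reversed. *)
have lny : y / (1 + y) <= ln (1 + y).
  have : ln (1 + y)^-1 <= (1 + y)^-1 - 1.
    rewrite -[in leLHS](subrK 1 (1 + y)^-1) addrC.
    by apply: le_ln1Dx; rewrite ltrBrDl subrr invr_gt0.
  rewrite lnV ?posrE// => h; have : (1 + y)^-1 - 1 = - (y / (1 + y)) by field; lra.
  lra.
have yy : y / kappa p rho ^+ 2 <= y / (1 + y) by rewrite ler_wpM2l// lef_pV2 ?posrE.
have : rho ^+ 2 / kappa p rho ^+ 2 * move t w ^+ 2 <= 2 * (ln (Lt t.+1 w) - ln (Lt t w)).
  by rewrite -lnE; apply: le_trans lny; rewrite mulrAC.
rewrite -(ler_pM2l (divr_gt0 k0 r0)).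
by congr (_ <= _); field; rewrite ?gt_eqF// (lt_le_trans _ k1).
Qed.

Lemma sum_move_le_ln T w : \sum_(t < T) move t w ^+ 2
  <= 2 * kappa p rho ^+ 2 / rho ^+ 2 * (ln (Lt T w) - ln rho).
Proof.
elim: T => [|T IH]; first by rewrite big_ord0 Lest0 subrr mulr0.
by rewrite big_ord_recr/=; have := move_le_ln T w; lra.
Qed.

Lemma fw_gap_ge0 t w : (0 <= fw_gap p (x t w))%E.
Proof.
apply: ereal_sup_ubound; exists (x t w) => //.
by rewrite subrr dot0r add0e subee// reg_fin_num.
Qed.

(** Optimality of [v t] for the linear model handles [g t], and the difference between the two
    gradients costs [dot err (x - u)], bounded by Cauchy-Schwarz and the diameter. Points outside
    the domain of [h] contribute [-oo]. *)
Lemma fw_gap_le t w :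
  (fw_gap p (x t w) <= (est_gap t w + D * norm2 (err t w))%:E)%E.
Proof.
apply: ge_ereal_sup => _ [u Xu <-].
have [hu|hu] := ltP (reg p u) +oo%E; last first.
  by move: hu; rewrite leye_eq => /eqP ->; rewrite reg_iterateE -EFinD leNye.
have := lmo_argmin Hs t w Xu.
rewrite reg_iterateE reg_lmoE -(fineK (reg_fin_num Hp hu)) -!EFinD !lee_fin.
have Dd : norm2 (x t w - u) <= D by apply: norm2_le_diam => //; exact: X_compact.
have := dot_le_norm2 (err t w) (x t w - u).
have := ler_wpM2l (norm2_ge0 (err t w)) Dd.
by rewrite /est_gap /err !dotBl !dotBr ![dot (g t w) _]dotC; lra.
Qed.

(* Each of the two error terms is split by AM-GM with weight [S], later [sqrt T]. *)
Lemma sum_gap_le T w (S : R) : 0 < S ->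
  \sum_(t < T) (est_gap t w + D * norm2 (err t w))
  <= (1 + S / 2) * \sum_(t < T) eta t w * est_gap t w
     + T%:R * D ^+ 2 / S * Lt T w
     + S / 2 * \sum_(t < T) norm2 (err t w) ^+ 2 / Lt t w.
Proof.
move=> S0; rewrite !mulr_sumr.
have -> : T%:R * D ^+ 2 / S * Lt T w = \sum_(t < T) (D ^+ 2 / S * Lt T w).
  by rewrite sumr_const card_ord -[RHS]mulr_natl; ring.
rewrite -!big_split/=; apply: ler_sum => t _.
have L0 := Lest_gt0 t w; have LT : Lt t w <= Lt T w by apply: Lest_homo; exact: ltnW.
have DS : 0 <= D ^+ 2 / S by rewrite divr_ge0 ?sqr_ge0// ltW.
have e2 : D * norm2 (err t w) <= D ^+ 2 * Lt t w / (2 * S) + S / 2 * (norm2 (err t w) ^+ 2 / Lt t w).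
  have SL : 0 < 2 * S * Lt t w by rewrite !mulr_gt0.
  rewrite -(ler_pM2l SL).
  have -> : 2 * S * Lt t w * (D ^+ 2 * Lt t w / (2 * S) + S / 2 * (norm2 (err t w) ^+ 2 / Lt t w))
     = (D * Lt t w) ^+ 2 + (S * norm2 (err t w)) ^+ 2.
    by field; rewrite !gt_eqF.
  have := sqr_ge0 (D * Lt t w - S * norm2 (err t w)); lra.
have halfE : D ^+ 2 * Lt t w / (2 * S) = D ^+ 2 / S * Lt t w / 2.
  by field; rewrite gt_eqF.
have := est_gap_le t w S0; have := ler_wpM2l DS LT; rewrite halfE in e2 *; lra.
Qed.

End Trajectory.

(** * Measurability with respect to the past *)

Section ProcessMeasurability.
Context {R : realType} {n N b : nat} {d : measure_display} {Omega : measurableType d}.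
Context (P : probability Omega R) (p : problem R n N) (rho : R) (q : nat)
  (x0 : 'rV[R]_n) (s : process R n N b d Omega).
Context (Hp : standing_assumptions p) (rho_gt0 : 0 < rho) (Hs : alfcg_fs P p rho q x0 s).
Local Notation pastT t := (g_sigma_algebraType (observable s t)).

Lemma measurable_past t (f : Omega -> R) :
  measurable_fun setT (f : pastT t -> R) -> measurable_fun setT f.
Proof.
move=> mf _ B mB; have := mf measurableT B mB; rewrite !setTI.
apply: (smallest_sub (sigma_algebra_measurable _)).
exact: (observable_measurable Hs (t := t)).
Qed.

Lemma measurable_iterate t i : (i <= t)%N -> measurable_coord (iterate s i : pastT t -> _).
Proof.
move=> it j _ B mB; rewrite setTI; apply: sub_sigma_algebra.
by apply: Or44; exists i, j, B.
Qed.

Lemma measurable_gest t i : (i < t)%N -> measurable_coord (gest s i : pastT t -> _).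
Proof.
move=> it j _ B mB; rewrite setTI; apply: sub_sigma_algebra.
by apply: Or42; exists i, j, B.
Qed.

Lemma measurable_move t i : (i < t)%N ->
  measurable_fun setT ((fun w => move s i w ^+ 2) : pastT t -> R).
Proof.
move=> it; apply: measurable_norm2_sqr.
by apply: measurable_coordB; apply: measurable_iterate; [|exact: ltnW].
Qed.

(** [Lest i] involves only moves before [i], hence iterates up to [i]. So index [t] itself is
    allowed, whereas [gest t] already depends on the batch drawn at time [t]. *)
Lemma measurable_Lest t i : (i <= t)%N -> measurable_fun setT (Lest s i : pastT t -> R).
Proof.
elim/ltn_ind: i => i IH it.
rewrite (_ : Lest s i = fun w => rho * Num.sqrt
    (1 + \sum_(k < i) Lest s k w ^+ 2 * move s k w ^+ 2)); last first.
  by apply/funext => w; rewrite (Lest_rule Hs).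
apply: measurable_funM => //; apply: measurable_sqrtr; apply: measurable_funD => //.
apply: measurable_sum => k; apply: measurable_funM.
  by apply: measurable_funX; apply: IH => //; rewrite (leq_trans _ it)// ltnW.
by apply: measurable_move; exact: leq_trans it.
Qed.

Lemma measurable_grad t i (k : 'I_N) : (i <= t)%N ->
  measurable_coord ((fun w => grad (component p k) (iterate s i w)) : pastT t -> _).
Proof.
move=> it; apply: measurable_grad_coord; first exact: measurable_iterate.
exact: f_differentiable.
Qed.

Lemma measurable_grad_favg t i : (i <= t)%N ->
  measurable_coord ((fun w => grad (favg p) (iterate s i w)) : pastT t -> _).
Proof.
move=> it; under eq_fun do rewrite (grad_favg Hp).
by apply: measurable_coordZ; apply: measurable_coord_sum => k; exact: measurable_grad.
Qed.

Lemma measurable_batch_grad t i (u : b.-tuple 'I_N) : (i <= t)%N ->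
  measurable_coord ((fun w => batch_grad p u (iterate s i w)) : pastT t -> _).
Proof.
move=> it; apply: measurable_coordZ; apply: measurable_coord_sum => k.
exact: measurable_grad.
Qed.

Lemma measurable_err t i : (i < t)%N -> measurable_coord (err p s i : pastT t -> _).
Proof.
move=> it; apply: measurable_coordB; last exact: measurable_gest.
by apply: measurable_grad_favg; exact: ltnW.
Qed.

Lemma measurable_div_Lest t i (f : pastT t -> R) : (i <= t)%N ->
  measurable_fun setT f -> measurable_fun setT ((fun w => f w / Lest s i w) : pastT t -> R).
Proof.
move=> it mf; apply: measurable_funM => //.
apply: measurable_invr; last exact: measurable_Lest.
by move=> w; apply: (Lest_gt0 rho_gt0 Hs).
Qed.

Lemma measurable_batch_eq t (u : b.-tuple 'I_N) : measurable [set w | batch s t w = u].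
Proof.
rewrite (_ : [set w | _] = \big[setI/setT]_(j < b) [set w | tnth (batch s t w) j = tnth u j]).
  apply: bigsetI_measurable => j _; apply: (observable_measurable Hs (t := t.+1)).
  by apply: Or41; exists t, j, (tnth u j).
rewrite -bigcap_seq; apply/seteqP; split=> w /= => [<- //|h].
by apply: eq_from_tnth => j; apply: h; rewrite /= mem_index_enum.
Qed.

Lemma batch_prob t (u : b.-tuple 'I_N) :
  P [set w | batch s t w = u] = (N%:R^-1 ^+ b)%:E.
Proof.
rewrite (batch_independent Hs) (eq_bigr (fun=> (N%:R^-1)%:E)); last first.
  by move=> j _; rewrite (batch_uniform Hs).
by rewrite prodEFin prodr_const card_ord.
Qed.

End ProcessMeasurability.

(** * Expected error of the gradient estimator *)

Section Variance.
Context {R : realType} {n N b : nat} {d : measure_display} {Omega : measurableType d}.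
Context (P : probability Omega R) (p : problem R n N) (rho : R) (q : nat)
  (x0 : 'rV[R]_n) (s : process R n N b d Omega).
Context (Hp : standing_assumptions p) (rho_gt0 : 0 < rho) (b_gt0 : (0 < b)%N)
  (Xx0 : feasible p x0) (hx0 : (reg p x0 < +oo)%E) (Hs : alfcg_fs P p rho q x0 s).
Local Notation L := (smooth p).

Definition weighted_err t w : R := norm2 (err p s t w) ^+ 2 / Lest s t w.
Definition weighted_move t w : R := move s t w ^+ 2 / Lest s t w.

Lemma weighted_err_ge0 t w : 0 <= weighted_err t w.
Proof. by apply: divr_ge0; [exact: sqr_ge0|exact/ltW/(Lest_gt0 rho_gt0 Hs)]. Qed.

Lemma weighted_move_ge0 t w : 0 <= weighted_move t w.
Proof. by apply: divr_ge0; [exact: sqr_ge0|exact/ltW/(Lest_gt0 rho_gt0 Hs)]. Qed.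

Lemma measurable_weighted_err t : measurable_fun setT (weighted_err t).
Proof.
apply: (measurable_past Hs (t := t.+1)).
apply: (measurable_div_Lest rho_gt0 Hs (leqnSn t)).
by apply: measurable_norm2_sqr; exact: (measurable_err Hp).
Qed.

Lemma measurable_weighted_move t : measurable_fun setT (weighted_move t).
Proof.
apply: (measurable_past Hs (t := t.+1)).
apply: (measurable_div_Lest rho_gt0 Hs (leqnSn t)).
exact: measurable_move.
Qed.

(** The batch is a fixed tuple [u], which makes the noise a function of the past for each [u]; the
    random batch is substituted afterwards. *)
Definition sampling_noise (u : b.-tuple 'I_N) t w : 'rV[R]_n :=
  (grad (favg p) (iterate s t.+1 w) - grad (favg p) (iterate s t w))
  - (batch_grad p u (iterate s t.+1 w) - batch_grad p u (iterate s t w)).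

Lemma err_recursive t w : ~~ (q %| t.+1)%N ->
  err p s t.+1 w = err p s t w + sampling_noise (batch s t.+1 w) t w.
Proof.
move=> qt; rewrite /err (gest_recursive Hs _ qt) /sampling_noise.
by apply/rowP => j; rewrite !mxE; ring.
Qed.

(** Coordinate by coordinate, this is the second moment of a constant plus a sum of centered terms;
    the variance is at most the mean squared change of the component gradients, which smoothness
    bounds by [L^2 move^2]. *)
Lemma mean_sampling_noise t w :
  N%:R^-1 ^+ b * \sum_(u : b.-tuple 'I_N) norm2 (err p s t w + sampling_noise u t w) ^+ 2
  <= norm2 (err p s t w) ^+ 2 + L ^+ 2 / b%:R * move s t w ^+ 2.
Proof.
have N0 := N_gt0 Hp; have nN : (N%:R : R) != 0 by rewrite pnatr_eq0 -lt0n.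
have nb : (b%:R : R) != 0 by rewrite pnatr_eq0 -lt0n.
pose Df i := grad (component p i) (iterate s t.+1 w) - grad (component p i) (iterate s t w).
pose M := grad (favg p) (iterate s t.+1 w) - grad (favg p) (iterate s t w).
have ME : M = N%:R^-1 *: \sum_i Df i.
  by rewrite /M !(grad_favg Hp) -scalerBr -sumrB.
pose c (j : 'I_n) i := b%:R^-1 * (M 0 j - Df i 0 j).
have sumc j : \sum_i c j i = 0.
  rewrite -mulr_sumr sumrB sumr_const card_ord ME mxE summxE.
  by rewrite -mulrnAl -[_ *+ N]mulr_natr mulVf// mul1r subrr mulr0.
have noiseE u j : sampling_noise u t w 0 j = \sum_(k < b) c j (tnth u k).
  rewrite /sampling_noise -/M /batch_grad -scalerBr -sumrB !mxE summxE.
  rewrite -mulr_sumr sumrB sumr_const card_ord mulrBr.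
  rewrite -[X in X - _ = _](mulKf nb) mulr_natl; congr (_ - _ * _).
  by rewrite /M !mxE.
rewrite [X in _ * X <= _](_ : _ = \sum_(j < n) \sum_(u : b.-tuple 'I_N) (err p s t w 0 j + \sum_(k < b) c j (tnth u k)) ^+ 2); last first.
  rewrite exchange_big/=; apply: eq_bigr => u _; rewrite norm2_sqr.
  by apply: eq_bigr => j _; rewrite mxE noiseE expr2.
rewrite mulr_sumr.
under eq_bigr => j _ do rewrite (batch_second_moment b _ N0 (sumc j)).
rewrite big_split/= norm2_sqr; apply: lerD.
  by rewrite /dot; under eq_bigr do rewrite expr2.
have step i : norm2 (Df i) ^+ 2 <= L ^+ 2 * move s t w ^+ 2.
  rewrite -exprMn lerXn2r ?nnegrE ?norm2_ge0//.
    by apply: mulr_ge0; [exact/ltW/L_gt0|exact: norm2_ge0].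
  by apply: (f_smooth Hp); exact: (iterate_dom Hp rho_gt0 Xx0 hx0 Hs _ w).1.
(* A variance is a second moment minus the squared mean [M 0 j ^+ 2], which is dropped. The factor
   [b^-2] in [c] against [b] summands leaves [1/b]. *)
have var j : b%:R * (N%:R^-1 * \sum_i c j i ^+ 2)
    <= b%:R^-1 * (N%:R^-1 * \sum_i Df i 0 j ^+ 2).
  have : \sum_i c j i ^+ 2 = b%:R^-1 ^+ 2 * (\sum_i Df i 0 j ^+ 2 - N%:R * M 0 j ^+ 2).
    have MN : \sum_i Df i 0 j = N%:R * M 0 j by rewrite ME mxE summxE mulVKf.
    have sq i : c j i ^+ 2 =
        b%:R^-1 ^+ 2 * (M 0 j ^+ 2 - 2 * M 0 j * Df i 0 j + Df i 0 j ^+ 2).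
      by rewrite /c; ring.
    rewrite (eq_bigr _ (fun i _ => sq i)) -mulr_sumr big_split sumrB/=.
    rewrite -[X in _ - X]mulr_sumr MN sumr_const card_ord -[M 0 j ^+ 2 *+ N]mulr_natl; ring.
  move=> ->; rewrite [leLHS](_ : _ = b%:R^-1 * (N%:R^-1 * \sum_i Df i 0 j ^+ 2)
     - b%:R^-1 * M 0 j ^+ 2); last by field; rewrite nN nb.
  by rewrite gerBl mulr_ge0 ?invr_ge0 ?sqr_ge0.
apply: le_trans (ler_sum _ (fun j _ => var j)) _.
rewrite -mulr_sumr -mulr_sumr exchange_big/= [L ^+ 2 / _]mulrC -mulrA ler_wpM2l ?invr_ge0//.
rewrite mulrC ler_pdivrMr ?ltr0n// mulrC.
rewrite mulr_natl -[X in _ *+ X]card_ord -sumr_const; apply: ler_sum => i _.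
apply: le_trans (step i); rewrite norm2_sqr.
by under eq_bigr do rewrite expr2.
Qed.

Local Open Scope ereal_scope.

Definition mean_err t : \bar R := \int[P]_w (weighted_err t w)%:E.
Definition mean_move t : \bar R := \int[P]_w (weighted_move t w)%:E.

Lemma mean_err_full t : (q %| t)%N -> mean_err t = 0.
Proof.
move=> qt; apply: integral0_eq => w _.
by rewrite /weighted_err /err (gest_full Hs _ qt) subrr norm20 expr0n mul0r.
Qed.

Lemma mean_err_recursive t : ~~ (q %| t.+1)%N ->
  mean_err t.+1 <= mean_err t + (L ^+ 2 / b%:R)%:E * mean_move t.
Proof.
move=> qt.
(* [f u] is the weighted error that batch [u] would produce. It is a function of the past, hence
   independent of [E u]; on [E u] it is the true weighted error, and the events [E u] partition the
   sample space. *)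
pose f u w : R := (norm2 (err p s t w + sampling_noise u t w) ^+ 2 / Lest s t.+1 w)%R.
pose E u := [set w | batch s t.+1 w = u].
have mE u : measurable (E u) by exact: (measurable_batch_eq Hs).
have mf u : measurable_fun setT (f u : g_sigma_algebraType (observable s t.+1) -> R).
  apply: (measurable_div_Lest rho_gt0 Hs (leqnn _)); apply: measurable_norm2_sqr.
  apply: measurable_coordD; first exact: (measurable_err Hp).
  apply: measurable_coordB; apply: measurable_coordB.
  - exact: (measurable_grad_favg Hp).
  - exact: (measurable_grad_favg Hp).
  - exact: (measurable_batch_grad Hp).
  - exact: (measurable_batch_grad Hp).
have f0 u w : (0 <= f u w)%R.
  by apply: divr_ge0; [exact: sqr_ge0|exact/ltW/(Lest_gt0 rho_gt0 Hs)].
have mfT u : measurable_fun setT (fun w => (f u w)%:E).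
  exact/measurable_EFinP/(measurable_past Hs (mf u)).
have c0 : (0 <= N%:R^-1 ^+ b :> R)%R by rewrite exprn_ge0.
have split_batch : mean_err t.+1 = \sum_(u : b.-tuple 'I_N) \int[P]_(w in E u) (f u w)%:E.
  rewrite /mean_err; transitivity (\int[P]_w
      (\sum_(u : b.-tuple 'I_N) ((fun w => (f u w)%:E) \_ (E u)) w)).
    apply: eq_integral => w _; rewrite (bigD1 (batch s t.+1 w))//= big1 => [|u nu].
      by rewrite adde0 patchE mem_set// /weighted_err (err_recursive _ qt).
    by rewrite patchE memNset//= => bu; rewrite bu eqxx in nu.
  rewrite ge0_integral_sum//.
  - by apply: eq_bigr => u _; rewrite [RHS]integral_mkcond.
  - by move=> u; apply/(measurable_restrictT _ (mE u)); exact: measurable_funTS.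
  - by move=> u w _; rewrite patchE; case: ifP => // _; rewrite lee_fin.
have indep u : \int[P]_(w in E u) (f u w)%:E = (N%:R^-1 ^+ b)%:E * \int[P]_w (f u w)%:E.
  rewrite -(batch_prob Hs t.+1 u).
  apply: (ge0_integral_independent (G := observable s t.+1)) => //.
  - exact: (observable_measurable Hs).
  - by move=> A pA; exact: (batch_past_independent Hs).
  - exact/measurable_EFinP.
  - by move=> w; rewrite lee_fin.
rewrite split_batch (eq_bigr _ (fun u _ => indep u)).
have mean_pos : \sum_(u : b.-tuple 'I_N) (N%:R^-1 ^+ b)%:E * \int[P]_w (f u w)%:E
   = \int[P]_w (N%:R^-1 ^+ b * \sum_(u : b.-tuple 'I_N) f u w)%:E.
  under [RHS]eq_integral do rewrite mulr_sumr -sumEFin.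
  rewrite ge0_integral_sum//.
  - apply: eq_bigr => u _; under [RHS]eq_integral do rewrite EFinM.
    by rewrite ge0_integralZl_EFin// => w _; rewrite lee_fin.
  - by move=> u; apply/measurable_EFinP/measurable_funM => //; exact/(measurable_past Hs (mf u)).
  - by move=> u w _; rewrite lee_fin mulr_ge0.
rewrite mean_pos.
have mwe := measurable_weighted_err t; have mwm := measurable_weighted_move t.
have k0 : (0 <= L ^+ 2 / b%:R)%R by apply: divr_ge0; [exact: sqr_ge0|].
have -> : mean_err t + (L ^+ 2 / b%:R)%:E * mean_move t =
    \int[P]_w (weighted_err t w + L ^+ 2 / b%:R * weighted_move t w)%:E.
  under [RHS]eq_integral do rewrite EFinD (EFinM (L ^+ 2 / _)).
  rewrite ge0_integralD//.
  - rewrite ge0_integralZl_EFin//; last exact/measurable_EFinP.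
    by move=> w _; rewrite lee_fin weighted_move_ge0.
  - by move=> w _; rewrite lee_fin weighted_err_ge0.
  - exact/measurable_EFinP.
  - by move=> w _; rewrite -EFinM lee_fin mulr_ge0// weighted_move_ge0.
  - by under eq_fun do rewrite -EFinM; apply/measurable_EFinP; exact: measurable_funM.
apply: ge0_le_integral => //.
- by move=> w _; rewrite lee_fin mulr_ge0// sumr_ge0.
- apply/measurable_EFinP/measurable_funM => //; apply: measurable_sum => u.
  exact/(measurable_past Hs (mf u)).
- by apply/measurable_EFinP/measurable_funD => //; exact: measurable_funM.
move=> w _; rewrite lee_fin.
have L0 := Lest_gt0 rho_gt0 Hs t w; have L1 := Lest_gt0 rho_gt0 Hs t.+1 w.
rewrite /f -mulr_suml mulrA /weighted_err /weighted_move mulrA -mulrDl.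
apply: le_trans (ler_wpM2r _ (mean_sampling_noise t w)) _; first by rewrite invr_ge0 ltW.
apply: ler_wpM2l.
  by apply: addr_ge0; [exact: sqr_ge0|apply: mulr_ge0 => //; exact: sqr_ge0].
(* Monotonicity of [Lest] changes the weight from [Lest t.+1] to [Lest t]. *)
by rewrite lef_pV2 ?posrE//; exact: (Lest_homo rho_gt0 Hs).
Qed.

End Variance.

(** * Comparison of integrals and summation over epochs *)

Section Integral.
Context {R : realType} {d : measure_display} {T : measurableType d}.
Local Open Scope ereal_scope.

(** The integral of a nonnegative function is a supremum over the simple functions below it, which
    is monotone for arbitrary functions; this is what lets the gaps be integrated. *)
Lemma ge0_le_integral_nonmeasurable (mu : {measure set T -> \bar R}) (f g : T -> \bar R) :
  (forall w, 0 <= f w) -> (forall w, f w <= g w) ->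
  \int[mu]_w f w <= \int[mu]_w g w.
Proof.
move=> f0 fg; have g0 w : 0 <= g w := le_trans (f0 w) (fg w).
rewrite !ge0_integralTE//; apply: le_ereal_sup => _ [h hf <-].
by exists h => // w; exact: le_trans (hf w) (fg w).
Qed.

Lemma integral_affine (P : probability T R) (V U : T -> R) (EV EU c k l : R) :
  measurable_fun setT V -> measurable_fun setT U ->
  (forall w, 0 <= V w)%R -> (forall w, 0 <= U w)%R ->
  \int[P]_w (V w)%:E = EV%:E -> \int[P]_w (U w)%:E = EU%:E ->
  (0 <= c)%R -> (0 <= k)%R -> (0 <= l)%R ->
  \int[P]_w (c + k * V w + l * U w)%:E = (c + k * EV + l * EU)%:E.
Proof.
move=> mV mU V0 U0 iV iU c0 k0 l0.
have mkV : measurable_fun setT (fun w => (k * V w)%:E).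
  by apply/measurable_EFinP; exact: measurable_funM.
have mlU : measurable_fun setT (fun w => (l * U w)%:E).
  by apply/measurable_EFinP; exact: measurable_funM.
have kV0 w : 0 <= (k * V w)%:E by rewrite lee_fin mulr_ge0.
have lU0 w : 0 <= (l * U w)%:E by rewrite lee_fin mulr_ge0.
have ckV0 w : 0 <= c%:E + (k * V w)%:E by rewrite adde_ge0.
have mckV : measurable_fun setT (fun w => c%:E + (k * V w)%:E).
  by apply: emeasurable_funD => //; exact: measurable_cst.
under eq_integral do rewrite 2!EFinD.
rewrite ge0_integralD//= ge0_integralD//=.
have ic : \int[P]_w c%:E = c%:E.
  by have := integral_cst P measurableT c%:E; rewrite /cst => ->; rewrite [X in _ * X]probability_setT mule1.
rewrite ic.
under [X in _ + X + _]eq_integral do rewrite EFinM.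
under [X in _ + _ + X]eq_integral do rewrite EFinM.
rewrite !ge0_integralZl_EFin//; try exact/measurable_EFinP; try by move=> w _; rewrite lee_fin.
by rewrite iV iU !EFinD !EFinM.
Qed.

End Integral.

(* Potential-function form of the epoch argument: [a] restarts from 0 at every multiple
   of [q], so each increment [c * m t] is counted at most [q] times. *)
Lemma epoch_sum (R : realDomainType) (a m : nat -> R) (c : R) (q T : nat) :
  (0 < q)%N -> 0 <= c -> (forall t, 0 <= a t) -> (forall t, 0 <= m t) ->
  (forall t, (q %| t)%N -> a t = 0) ->
  (forall t, ~~ (q %| t.+1)%N -> a t.+1 <= a t + c * m t) ->
  \sum_(t < T) a t <= q%:R * c * \sum_(t < T) m t.
Proof.
move=> q0 c0 a0 m0 full rec.
(* From [T] on, the current epoch still has [q - T %% q] indices, and [a T] may recur in each of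
   them. *)
suff : \sum_(t < T) a t + (q - T %% q)%:R * a T <= q%:R * c * \sum_(t < T) m t.
  by apply: le_trans; rewrite lerDl mulr_ge0.
elim: T => [|T IH]; first by rewrite !big_ord0 full// !mulr0 addr0.
rewrite !big_ord_recr/= mulrDr.
have qm : (T %% q < q)%N by rewrite ltn_mod.
have qE : (q - T %% q)%:R = 1 + (q - (T %% q).+1)%:R :> R.
  by rewrite -(subnSK qm) -natr1 addrC.
have cm : 0 <= q%:R * c * m T by rewrite !mulr_ge0.
have aT : 0 <= (q - (T %% q).+1)%:R * a T by rewrite mulr_ge0.
have [qT|qT] := boolP (q %| T.+1)%N.
  by rewrite (full _ qT) mulr0; move: IH; rewrite qE; lra.
have modS : (T.+1 %% q = (T %% q).+1)%N.
  rewrite -addn1 -modnDml addn1 modn_small// ltn_neqAle qm andbT.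
  by apply: contra qT => /eqP e; rewrite /dvdn -addn1 -modnDml addn1 e modnn.
have kq : (q - (T %% q).+1)%:R * (c * m T) <= q%:R * (c * m T).
  by rewrite ler_wpM2r ?mulr_ge0// ler_nat leq_subr.
have := ler_wpM2l (ler0n R (q - (T %% q).+1)) (rec T qT).
by rewrite modS; move: IH kq; rewrite qE !mulrDr; lra.
Qed.

(** * The scalar inequality behind the constant *)

Section Arithmetic.
Context {R : realType}.

(** [EV], [EB] and [ER] stand for the expected sums of weighted errors, weighted moves and squared
    moves, [y] for the expected progress bound, [M0] for the logarithmic terms. The left side will
    bound [sqrt T] times the expected average gap. *)
Lemma gap_const_bound (gap0 rho D L K M0 Lp EV EB ER F y : R) :
  0 < rho -> 0 <= gap0 -> 0 <= L -> 0 <= K -> 0 <= M0 ->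
  rho + 16 * K / rho <= Lp ->
  F = 2 * (gap0 + rho * D ^+ 2 + M0 + Lp / (8 * rho ^+ 2)) ->
  y = 4 / 3 * (gap0 + EV + L / 2 * ER) ->
  0 <= EV -> 0 <= ER ->
  EV <= K * EB -> EB <= ER / rho -> EB <= y / rho ^+ 2 ->
  (K / rho + L / 2) * ER <= M0 + 1 / (8 * rho) + y / 16 ->
  3 / 2 * y + D ^+ 2 * rho + D ^+ 2 * rho ^+ 2 / 2 * y + EV / 2
    <= F * (Lp + 4 * rho ^+ 2 * F) / rho.
Proof.
move=> r0 g0 L0 K0 M00 LpE FE yE EV0 ER0 EVB EBR EBy mom.
have y0 : 0 <= y by rewrite yE mulr_ge0// addr_ge0 ?mulr_ge0// ?addr_ge0// divr_ge0.
pose i := rho^-1; have i0 : 0 < i by rewrite invr_gt0.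
have ri : rho * i = 1 by rewrite mulfV ?gt_eqF.
pose k := K * i ^+ 2; have k0 : 0 <= k by rewrite mulr_ge0// sqr_ge0.
have Lpi : 1 + 16 * k <= Lp * i.
  have := ler_wpM2r (ltW i0) LpE.
  by rewrite mulrDl ri (_ : 16 * K / rho * i = 16 * k)// /k /i expr2; ring.
have F0 : i / 8 * (1 + 16 * k) <= Lp / (8 * rho ^+ 2).
  rewrite (_ : Lp / (8 * rho ^+ 2) = i / 8 * (Lp * i)).
    by rewrite ler_wpM2l// divr_ge0// ltW.
  by rewrite /i; field; rewrite gt_eqF.
have rD0 : 0 <= rho * D ^+ 2 by apply: mulr_ge0; [exact: ltW|exact: sqr_ge0].
have ik0 : 0 <= i * k by rewrite mulr_ge0// ltW.
have EVk : EV <= k * y.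
  apply: le_trans EVB _; have := ler_wpM2l K0 EBy.
  by rewrite (_ : K * (y / rho ^+ 2) = k * y)// /k /i; field; rewrite gt_eqF.
have EVR : EV <= K / rho * ER.
  by apply: le_trans EVB _; have := ler_wpM2l K0 EBR; rewrite mulrA mulrAC.
have r8 : 1 / (8 * rho) = i / 8 by rewrite /i; field; rewrite gt_eqF.
(* The hypotheses give [y <= 4/3 * (gap0 + M0 + 1/(8 rho) + y/16)]. Absorbing [y / 12] leaves
   [11/12 * y], and the other three terms of the bracket sum to at most [F / 2]. *)
have yF : y <= 8 / 11 * F.
  by move: mom; rewrite r8 mulrDl => mom; rewrite FE; lra.
(* This lower bound on [rho * F] lets multiples of [F] be absorbed by the quadratic term
   [4 * rho * F^2]. *)
have uF : 1 / 4 <= rho * F.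
  have h : i / 4 <= F by rewrite FE; lra.
  by have := ler_wpM2l (ltW r0) h; rewrite mulrA ri.
have DF : rho * D ^+ 2 <= F / 2 by rewrite FE; lra.
have F00 : 0 < F.
  by rewrite -(pmulr_rgt0 _ r0); apply: lt_le_trans uF; rewrite divr_gt0.
rewrite (_ : F * (Lp + 4 * rho ^+ 2 * F) / rho = F * (Lp * i + 4 * (rho * F))); last first.
  by rewrite /i; field; rewrite gt_eqF.
have h1 : F * (1 + 16 * k + 4 * (rho * F)) <= F * (Lp * i + 4 * (rho * F)).
  by rewrite ler_wpM2l ?(ltW F00)// lerD2r.
apply: le_trans h1.
have h2 : D ^+ 2 * rho ^+ 2 / 2 * y <= F * (2 / 11 * (rho * F)).
  have := ler_pM rD0 y0 DF yF => h.
  have := ler_wpM2l (ltW r0) h; lra.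
have h3 : k * y <= k * (8 / 11 * F) by rewrite ler_wpM2l.
have h4 : F * (1 / 4) <= F * (rho * F) by rewrite ler_wpM2l// ltW.
have h5 : 0 <= F * k by rewrite mulr_ge0// ltW.
lra.
Qed.

End Arithmetic.

(** * Expected progress and gaps *)

Section Rate.
Context {R : realType} {n N b : nat} {d : measure_display} {Omega : measurableType d}.
Context (P : probability Omega R) (p : problem R n N) (rho : R) (q : nat)
  (x0 : 'rV[R]_n) (s : process R n N b d Omega).
Context (Hp : standing_assumptions p) (rho_gt0 : 0 < rho) (b_gt0 : (0 < b)%N)
  (q_gt0 : (0 < q)%N)
  (Xx0 : feasible p x0) (hx0 : (reg p x0 < +oo)%E) (Hs : alfcg_fs P p rho q x0 s).
Local Notation D := (diam (feasible p)).
Local Notation L := (smooth p).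
Local Notation K := (L ^+ 2 * q%:R / b%:R).
Local Notation kap := (kappa p rho).
Local Notation om := (omega p rho q b).
Local Notation lam := (lambda p rho q b).
Local Notation Lp := (L_prime p rho q b).
Local Notation Fb := (F_bar p rho q b x0).
Local Notation gap0 := (fine (objective p x0) - fine (optval p)).
Local Notation drift := (om * `|ln rho| + om * `|ln lam|).

Let L0 : 0 < L. Proof. exact: L_gt0. Qed.
Let b0 : 0 < b%:R :> R. Proof. by rewrite ltr0n. Qed.
Let kap1 : 1 <= kap. Proof. exact: kappa_ge1. Qed.
Let kap0 : 0 < kap. Proof. exact: lt_le_trans ltr01 kap1. Qed.
Let kapX0 k : 0 < kap ^+ k. Proof. exact: exprn_gt0. Qed.
Let rho2 : 0 < rho ^+ 2. Proof. exact: exprn_gt0. Qed.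
Let rho3 : 0 < rho ^+ 3. Proof. exact: exprn_gt0. Qed.
Let D0 : 0 <= D. Proof. by apply: diam_ge0; [exact: X_compact|exists x0]. Qed.
Let D20 : 0 <= D ^+ 2. Proof. exact: sqr_ge0. Qed.
Let K0 : 0 <= K.
Proof. by apply: divr_ge0 => //; apply: mulr_ge0 => //; exact: sqr_ge0. Qed.

Lemma omegaE : om = L * kap ^+ 2 / rho ^+ 2 + 4 * K * kap ^+ q.+1 / rho ^+ 3.
Proof. by rewrite /omega; field; rewrite !gt_eqF. Qed.

Lemma omega_gt0 : 0 < om.
Proof.
rewrite omegaE; apply: ltr_wpDr.
  exact: divr_ge0 (mulr_ge0 (mulr_ge0 (ler0n R 4) K0) (ltW (kapX0 _))) (ltW rho3).
exact: divr_gt0 (mulr_gt0 L0 (kapX0 2)) rho2.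
Qed.

(** [lambda] is tuned for this: [omega * lambda * Lest T] then costs only [1/(8 rho)] plus a
    sixteenth of the progress bound. *)
Lemma omega_lambda : om * lam = (8 * rho ^+ 2)^-1.
Proof. by have o0 := omega_gt0; rewrite /lambda; field; rewrite !gt_eqF. Qed.

Lemma lambda_gt0 : 0 < lam.
Proof.
by rewrite invr_gt0; exact: mulr_gt0 (mulr_gt0 (ltr0Sn R 7) rho2) omega_gt0.
Qed.

Lemma L_prime_ge : rho + 16 * K / rho <= Lp.
Proof.
have -> : Lp = 4 * rho ^+ 3 * D ^+ 2 + 4 * L * kap + 16 * K / rho * kap ^+ q + rho.
  by rewrite /L_prime; field; rewrite !gt_eqF.
have h1 : 0 <= 4 * rho ^+ 3 * D ^+ 2 by exact: mulr_ge0 (mulr_ge0 (ler0n R 4) (ltW rho3)) D20.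
have h2 : 0 <= 4 * L * kap by exact: mulr_ge0 (mulr_ge0 (ler0n R 4) (ltW L0)) (ltW kap0).
have h3 : 16 * K / rho <= 16 * K / rho * kap ^+ q.
  apply: ler_peMr; last exact: exprn_ege1.
  exact: divr_ge0 (mulr_ge0 (ler0n R 16) K0) (ltW rho_gt0).
lra.
Qed.

Lemma gap0_ge0 : 0 <= gap0.
Proof.
(* The comparison with the optimal value is stated along trajectories, so one sample point is
   picked. *)
have [w _] : exists w : Omega, True by exists point.
have := optval_le_value Hp rho_gt0 Xx0 hx0 Hs 0 w.
by rewrite /value (iterate0 Hs) /objective -(fineK (reg_fin_num Hp hx0)) subr_ge0.
Qed.

Lemma drift_ge0 : 0 <= drift.
Proof. by apply: addr_ge0; apply: mulr_ge0 => //; exact/ltW/omega_gt0. Qed.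

Lemma F_barE : Fb = 2 * (gap0 + rho * D ^+ 2 + drift + Lp / (8 * rho ^+ 2)).
Proof. by rewrite /F_bar omega_lambda; field; rewrite gt_eqF. Qed.

Lemma L_prime_gt0 : 0 < Lp.
Proof.
apply: lt_le_trans L_prime_ge; apply: ltr_wpDr => //.
exact: divr_ge0 (mulr_ge0 (ler0n R 16) K0) (ltW rho_gt0).
Qed.

Lemma F_bar_gt0 : 0 < Fb.
Proof.
rewrite F_barE mulr_gt0//; apply: ltr_wpDl.
  exact: addr_ge0 (addr_ge0 gap0_ge0 (mulr_ge0 (ltW rho_gt0) D20)) drift_ge0.
exact: divr_gt0 L_prime_gt0 (mulr_gt0 (ltr0Sn R 7) rho2).
Qed.

Lemma gap_const_gt0 : 0 < gap_const p rho q b x0.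
Proof.
have F0 := F_bar_gt0; rewrite /gap_const /L_bar.
have h := addr_gt0 L_prime_gt0 (mulr_gt0 (mulr_gt0 (ltr0Sn R 3) rho2) F0).
exact: divr_gt0 (mulr_gt0 F0 h) rho_gt0.
Qed.

(** The progress involves [reg p]; it is replaced by [progress_bound], an affine function of these
    two measurable sums, so that pathwise bounds pass to expectations. *)
Definition sum_err T w : R := \sum_(t < T) weighted_err p s t w.
Definition sum_move T w : R := \sum_(t < T) move s t w ^+ 2.
Definition progress_bound T w : R := 4 / 3 * (gap0 + sum_err T w + L / 2 * sum_move T w).

Let prog T w : \sum_(t < T) eta p s t w * est_gap p s t w <= progress_bound T w.
Proof. exact: (sum_progress_le Hp rho_gt0 Xx0 hx0 Hs T w). Qed.

Lemma Lest_le_progress_bound T w :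
  Lest s T w <= rho + rho ^+ 2 / 2 * progress_bound T w.
Proof.
apply: le_trans (Lest_le_progress Hp rho_gt0 Xx0 hx0 Hs T w) _.
have r22 : 0 <= rho ^+ 2 / 2 by apply: divr_ge0 => //; exact: ltW.
by rewrite lerD2l; exact: (ler_wpM2l r22 (prog T w)).
Qed.

(* [ln W <= |ln lam| + lam W] closes the recursion between the iterate lengths and the
   final step-size parameter [W]. *)
Lemma sum_move_le T w :
  (K / rho + L / 2) * sum_move T w <= drift + 1 / (8 * rho) + progress_bound T w / 16.
Proof.
set W := Lest s T w; have W0 : 0 < W by apply: (Lest_gt0 rho_gt0 Hs).
have lnW : 0 <= ln W - ln rho.
  by rewrite subr_ge0 ler_ln ?posrE// (Lest_ge rho_gt0 Hs).
have KL : 0 <= K / rho + L / 2.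
  exact: addr_ge0 (divr_ge0 K0 (ltW rho_gt0)) (divr_ge0 (ltW L0) (ler0n R 2)).
(* The first summand of [omega] is exactly the [L] part; the second dominates the [K] part because
   [kap^2 <= kap^(q+1)]. *)
have coef : (K / rho + L / 2) * (2 * kap ^+ 2 / rho ^+ 2) <= om.
  have -> : (K / rho + L / 2) * (2 * kap ^+ 2 / rho ^+ 2)
      = L * kap ^+ 2 / rho ^+ 2 + K / rho ^+ 3 * (2 * kap ^+ 2).
    by field; rewrite !gt_eqF.
  have -> : om = L * kap ^+ 2 / rho ^+ 2 + K / rho ^+ 3 * (4 * kap ^+ q.+1).
    by rewrite omegaE; ring.
  rewrite lerD2l; apply: ler_wpM2l; first exact: divr_ge0 K0 (ltW rho3).
  have kq : kap ^+ 2 <= kap ^+ q.+1 by apply: ler_weXn2l.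
  by have := ltW (kapX0 q.+1); lra.
have main : (K / rho + L / 2) * sum_move T w <= om * (ln W - ln rho).
  apply: le_trans (ler_wpM2l KL (sum_move_le_ln Hp rho_gt0 Xx0 hx0 Hs T w)) _.
  by rewrite mulrA; apply: ler_wpM2r.
have l0 := lambda_gt0.
have lnWE : ln W <= `|ln lam| + lam * W.
  have : ln (lam * W) <= lam * W by apply/ltW/ln_sublinear; exact: mulr_gt0.
  rewrite lnM ?posrE//; have := ler_norm (- ln lam); rewrite normrN; lra.
have h : ln W - ln rho <= `|ln rho| + `|ln lam| + lam * W.
  by have := ler_norm (- ln rho); rewrite normrN; lra.
have h' : om * (ln W - ln rho) <= drift + (8 * rho ^+ 2)^-1 * W.
  apply: le_trans (ler_wpM2l (ltW omega_gt0) h) _.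
  by rewrite -omega_lambda le_eqVlt; apply/orP; left; apply/eqP; ring.
apply: le_trans main _; apply: le_trans h' _.
rewrite -[leRHS]addrA lerD2l.
have c0 : 0 <= (8 * rho ^+ 2)^-1.
  by rewrite invr_ge0; exact: mulr_ge0 (ler0n R 8) (ltW rho2).
apply: le_trans (ler_wpM2l c0 (Lest_le_progress_bound T w)) _.
rewrite le_eqVlt; apply/orP; left; apply/eqP.
by field; rewrite !gt_eqF.
Qed.

Let wm T w := \sum_(t < T) weighted_move s t w.

Lemma weighted_move_le_move T w : wm T w <= 1 / rho * sum_move T w.
Proof.
rewrite mulr_sumr; apply: ler_sum => t _.
rewrite /weighted_move (mulrC (_ ^+ 2)) mul1r; apply: ler_wpM2r; first exact: sqr_ge0.
by rewrite lef_pV2 ?posrE ?(Lest_gt0 rho_gt0 Hs)//; exact: (Lest_ge rho_gt0 Hs).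
Qed.

(** [move^2 / Lest] is [Lest * move^2] divided by [Lest^2 >= rho^2], and [Lest * move^2] is bounded
    by the progress of the step. *)
Lemma weighted_move_le_progress T w : wm T w <= 1 / rho ^+ 2 * progress_bound T w.
Proof.
have i0 : 0 <= 1 / rho ^+ 2 by apply: divr_ge0 => //; exact: ltW.
apply: le_trans (ler_wpM2l i0 (prog T w)).
rewrite mulr_sumr; apply: ler_sum => t _.
have Lt0 := Lest_gt0 rho_gt0 Hs t w.
apply: le_trans (ler_wpM2l i0 (Lest_move_le Hp rho_gt0 Xx0 hx0 Hs t w)).
rewrite /weighted_move mulrA (mulrC (_ ^+ 2)); apply: ler_wpM2r; first exact: sqr_ge0.
rewrite -(ler_pM2r Lt0) mulVf ?gt_eqF//.
have -> : 1 / rho ^+ 2 * Lest s t w * Lest s t w = Lest s t w ^+ 2 / rho ^+ 2 by ring.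
rewrite ler_pdivlMr// mul1r ler_pXn2r ?nnegrE ?(ltW rho_gt0) ?(ltW Lt0)//.
exact: (Lest_ge rho_gt0 Hs).
Qed.

Lemma integral_sum_fin (f : nat -> Omega -> R) (e : nat -> R) T :
  (forall t, measurable_fun setT (f t)) -> (forall t w, 0 <= f t w) ->
  (forall t, \int[P]_w (f t w)%:E = (e t)%:E)%E ->
  (\int[P]_w (\sum_(t < T) f t w)%:E = (\sum_(t < T) e t)%:E)%E.
Proof.
move=> mf f0 fe; under eq_integral do rewrite -sumEFin.
rewrite ge0_integral_sum//.
- by rewrite -sumEFin; apply: eq_bigr.
- by move=> t; apply/measurable_EFinP.
- by move=> t w _; rewrite lee_fin.
Qed.

Lemma integral_bounded_fin (f : Omega -> R) (c : R) :
  measurable_fun setT f -> (forall w, 0 <= f w <= c) ->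
  (\int[P]_w (f w)%:E)%E \is a fin_num.
Proof.
move=> mf fc; rewrite ge0_fin_numE; last first.
  by apply: integral_ge0 => w _; rewrite lee_fin; case/andP: (fc w).
apply: (@le_lt_trans _ _ (\int[P]_w (cst c%:E w))%E); last first.
  by rewrite integral_cst// [X in (_ * X)%E]probability_setT mule1 ltry.
apply: ge0_le_integral_nonmeasurable => w; rewrite lee_fin; by case/andP: (fc w).
Qed.

Lemma move_sqr_le t w : move s t w ^+ 2 <= D ^+ 2.
Proof.
rewrite ler_pXn2r ?nnegrE ?move_ge0//.
exact: (move_le_diam Hp rho_gt0 Xx0 hx0 Hs).
Qed.

Lemma mean_move_fin t : mean_move P s t \is a fin_num.
Proof.
apply: (@integral_bounded_fin _ (D ^+ 2 / rho)).
  exact: (measurable_weighted_move rho_gt0 Hs).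
move=> w; rewrite (weighted_move_ge0 rho_gt0 Hs)/=.
have Lt0 := Lest_gt0 rho_gt0 Hs t w.
apply: ler_pM.
- exact: sqr_ge0.
- by rewrite invr_ge0 ltW.
- exact: move_sqr_le.
- by rewrite lef_pV2 ?posrE//; exact: (Lest_ge rho_gt0 Hs).
Qed.

(** Finiteness propagates through the recursion from the exact gradient at time 0, each increment
    being finite since the moves are bounded. *)
Lemma mean_err_fin t : mean_err P p s t \is a fin_num.
Proof.
elim: t => [|t IH]; first by rewrite (mean_err_full Hs (dvdn0 q)).
have [qt|qt] := boolP (q %| t.+1)%N; first by rewrite (mean_err_full Hs qt).
rewrite ge0_fin_numE; last first.
  by apply: integral_ge0 => w _; rewrite lee_fin (weighted_err_ge0 rho_gt0 Hs).
apply: le_lt_trans (mean_err_recursive Hp rho_gt0 b_gt0 Xx0 hx0 Hs qt) _.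
by rewrite -(fineK IH) -(fineK (mean_move_fin t)) -EFinM -EFinD ltry.
Qed.

Lemma sum_mean_err_le T :
  \sum_(t < T) fine (mean_err P p s t) <= K * \sum_(t < T) fine (mean_move P s t).
Proof.
rewrite (_ : K = q%:R * (L ^+ 2 / b%:R)); last by ring.
apply: (epoch_sum (a := fun t => fine (mean_err P p s t)) (m := fun t => fine (mean_move P s t))) => //.
- by apply: divr_ge0 => //; exact: sqr_ge0.
- move=> t; apply: fine_ge0; apply: integral_ge0 => w _.
  by rewrite lee_fin (weighted_err_ge0 rho_gt0 Hs).
- move=> t; apply: fine_ge0; apply: integral_ge0 => w _.
  by rewrite lee_fin (weighted_move_ge0 rho_gt0 Hs).
- by move=> t qt; rewrite (mean_err_full Hs qt).
- move=> t qt; have := mean_err_recursive Hp rho_gt0 b_gt0 Xx0 hx0 Hs qt.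
  rewrite -{1}(fineK (mean_err_fin t.+1)) -{1}(fineK (mean_err_fin t)).
  by rewrite -{1}(fineK (mean_move_fin t)) -EFinM -EFinD lee_fin.
Qed.

(** One measurable [Z] dominates the averaged estimates on every path, so it serves for both the
    average and the minimum gap. *)
Lemma dominating_gap_bound T : (0 < T)%N -> exists2 Z : Omega -> R,
  forall w, \sum_(t < T) (est_gap p s t w + D * norm2 (err p s t w)) <= T%:R * Z w &
  (\int[P]_w (Z w)%:E <= (gap_const p rho q b x0 / Num.sqrt T%:R)%:E)%E.
Proof.
move=> T0; set S := Num.sqrt T%:R.
have S1 : 1 <= S by rewrite -[leLHS]sqrtr1 ler_wsqrtr// ler1n.
have S0 : 0 < S := lt_le_trans ltr01 S1.
have TS : T%:R = S ^+ 2 by rewrite sqr_sqrtr.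
have SD0 : 0 <= S * D ^+ 2 by apply: mulr_ge0 => //; exact: ltW.
have S20 : 0 <= S / 2 by apply: divr_ge0 => //; exact: ltW.
have r22 : 0 <= rho ^+ 2 / 2 by apply: divr_ge0 => //; exact: ltW.
have c43 : 0 <= 4 / 3 :> R by rewrite divr_ge0.
have L2 : 0 <= L / 2 by apply: divr_ge0 => //; exact: ltW.
have g0 := gap0_ge0; have dr0 := drift_ge0.
have SS0 : 0 < S ^+ 2 by exact: exprn_gt0.
(* [c1] is the total coefficient of [progress_bound] once [sum_gap_le] and the bound on [Lest T] are
   combined; [c], [k], [l] are the resulting affine coefficients divided by [T = S^2]. *)
pose c1 := 1 + S / 2 + S * D ^+ 2 * (rho ^+ 2 / 2).
have c10 : 0 <= c1 := addr_ge0 (addr_ge0 ler01 S20) (mulr_ge0 SD0 r22).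
pose c := (c1 * (4 / 3 * gap0) + S * D ^+ 2 * rho) / S ^+ 2.
pose k := (c1 * (4 / 3) + S / 2) / S ^+ 2.
pose l := c1 * (4 / 3 * (L / 2)) / S ^+ 2.
have c0 : 0 <= c.
  apply: (divr_ge0 _ (ltW SS0)).
  exact: addr_ge0 (mulr_ge0 c10 (mulr_ge0 c43 g0)) (mulr_ge0 SD0 (ltW rho_gt0)).
have k0 : 0 <= k by apply: (divr_ge0 _ (ltW SS0)); exact: addr_ge0 (mulr_ge0 c10 c43) S20.
have l0 : 0 <= l by apply: (divr_ge0 _ (ltW SS0)); exact: mulr_ge0 c10 (mulr_ge0 c43 L2).
have mE T' : measurable_fun setT (sum_err T').
  by apply: measurable_sum => t; exact: (measurable_weighted_err Hp rho_gt0 Hs).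
have mM2 t : measurable_fun setT (fun w => move s t w ^+ 2).
  by apply: (measurable_past Hs (t := t.+1)); exact: measurable_move.
have mM T' : measurable_fun setT (sum_move T') by apply: measurable_sum.
have mW T' : measurable_fun setT (wm T').
  by apply: measurable_sum => t; exact: (measurable_weighted_move rho_gt0 Hs).
have E0 T' w : 0 <= sum_err T' w.
  by apply: sumr_ge0 => t _; exact: (weighted_err_ge0 rho_gt0 Hs).
have M0 T' w : 0 <= sum_move T' w by apply: sumr_ge0 => t _; exact: sqr_ge0.
have W0 T' w : 0 <= wm T' w.
  by apply: sumr_ge0 => t _; exact: (weighted_move_ge0 rho_gt0 Hs).
pose EV := \sum_(t < T) fine (mean_err P p s t).
pose EB := \sum_(t < T) fine (mean_move P s t).
pose mm t := (\int[P]_w (move s t w ^+ 2)%:E)%E.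
pose ER := \sum_(t < T) fine (mm t).
have mm_fin t : mm t \is a fin_num.
  by apply: (@integral_bounded_fin _ (D ^+ 2)) => // w; rewrite sqr_ge0/= move_sqr_le.
have iV : (\int[P]_w (sum_err T w)%:E = EV%:E)%E.
  apply: (integral_sum_fin (f := weighted_err p s) (e := fun t => fine (mean_err P p s t))).
  - exact: (measurable_weighted_err Hp rho_gt0 Hs).
  - by move=> t w; exact: (weighted_err_ge0 rho_gt0 Hs).
  - by move=> t; rewrite fineK// mean_err_fin.
have iR : (\int[P]_w (sum_move T w)%:E = ER%:E)%E.
  apply: (integral_sum_fin (f := fun t w => move s t w ^+ 2) (e := fun t => fine (mm t))).
  - exact: mM2.
  - by move=> t w; exact: sqr_ge0.
  - by move=> t; rewrite fineK.
have iB : (\int[P]_w (wm T w)%:E = EB%:E)%E.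
  apply: (integral_sum_fin (f := weighted_move s) (e := fun t => fine (mean_move P s t))).
  - exact: (measurable_weighted_move rho_gt0 Hs).
  - by move=> t w; exact: (weighted_move_ge0 rho_gt0 Hs).
  - by move=> t; rewrite fineK// mean_move_fin.
have affine (f : Omega -> R) (E u v z : R) : (\int[P]_w (f w)%:E = E%:E)%E ->
    (forall w, 0 <= f w) -> 0 <= u -> 0 <= v -> 0 <= z ->
    (forall w, f w <= u + v * sum_err T w + z * sum_move T w) ->
    E <= u + v * EV + z * ER.
  move=> fE f0 u0 v0 z0 fle; rewrite -lee_fin -fE.
  rewrite -(integral_affine (mE T) (mM T) (E0 T) (M0 T) iV iR u0 v0 z0).
  by apply: ge0_le_integral_nonmeasurable => w; rewrite lee_fin.
pose y := 4 / 3 * (gap0 + EV + L / 2 * ER).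
have EV0 : 0 <= EV by rewrite -lee_fin -iV integral_ge0// => w _; rewrite lee_fin.
have ER0 : 0 <= ER by rewrite -lee_fin -iR integral_ge0// => w _; rewrite lee_fin.
have ir0 : 0 <= 1 / rho by apply: divr_ge0 => //; exact: ltW.
have ir20 : 0 <= 1 / rho ^+ 2 by apply: divr_ge0 => //; exact: ltW.
have EBR : EB <= ER / rho.
  have hw w : wm T w <= 0 + 0 * sum_err T w + 1 / rho * sum_move T w.
    by rewrite mul0r !add0r; exact: weighted_move_le_move.
  have := affine _ _ _ _ _ iB (W0 T) (lexx 0) (lexx 0) ir0 hw.
  by rewrite mul0r !add0r mul1r mulrC.
have EBy : EB <= y / rho ^+ 2.
  have hw w : wm T w <= 1 / rho ^+ 2 * (4 / 3 * gap0)
      + 1 / rho ^+ 2 * (4 / 3) * sum_err T w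
      + 1 / rho ^+ 2 * (4 / 3 * (L / 2)) * sum_move T w.
    apply: le_trans (weighted_move_le_progress T w) _.
    by rewrite le_eqVlt; apply/orP; left; apply/eqP; rewrite /progress_bound; ring.
  have := affine _ _ _ _ _ iB (W0 T) (mulr_ge0 ir20 (mulr_ge0 c43 g0))
    (mulr_ge0 ir20 c43) (mulr_ge0 ir20 (mulr_ge0 c43 L2)) hw.
  by congr (_ <= _); rewrite /y; ring.
have KL : 0 <= K / rho + L / 2 := addr_ge0 (divr_ge0 K0 (ltW rho_gt0)) L2.
have iKL : (\int[P]_w ((K / rho + L / 2) * sum_move T w)%:E = ((K / rho + L / 2) * ER)%:E)%E.
  under eq_integral do rewrite EFinM.
  rewrite ge0_integralZl_EFin ?iR//; last exact/measurable_EFinP.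
  by move=> w _; rewrite lee_fin.
have s16 : 0 <= 16^-1 :> R by rewrite invr_ge0.
have r8 : 0 <= 1 / (8 * rho) by apply: divr_ge0 => //; exact: mulr_ge0 (ler0n R 8) (ltW rho_gt0).
have mom : (K / rho + L / 2) * ER <= drift + 1 / (8 * rho) + y / 16.
  have hw w : (K / rho + L / 2) * sum_move T w <=
      (drift + 1 / (8 * rho) + 4 / 3 * gap0 / 16) + 4 / 3 / 16 * sum_err T w
      + 4 / 3 * (L / 2) / 16 * sum_move T w.
    apply: le_trans (sum_move_le T w) _.
    by rewrite le_eqVlt; apply/orP; left; apply/eqP; rewrite /progress_bound; ring.
  have := affine _ _ _ _ _ iKL (fun w => mulr_ge0 KL (M0 T w))
    (addr_ge0 (addr_ge0 dr0 r8) (mulr_ge0 (mulr_ge0 c43 g0) s16))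
    (mulr_ge0 c43 s16) (mulr_ge0 (mulr_ge0 c43 L2) s16) hw.
  by congr (_ <= _); rewrite /y; ring.
have final := gap_const_bound rho_gt0 g0 (ltW L0) K0 dr0 L_prime_ge F_barE (erefl y)
  EV0 ER0 (sum_mean_err_le T) EBR EBy mom.
exists (fun w => c + k * sum_err T w + l * sum_move T w).
  move=> w; apply: le_trans (sum_gap_le Hp rho_gt0 Xx0 hx0 Hs T w S0) _.
  have -> : T%:R * (c + k * sum_err T w + l * sum_move T w)
    = (1 + S / 2) * progress_bound T w
      + S * D ^+ 2 * (rho + rho ^+ 2 / 2 * progress_bound T w) + S / 2 * sum_err T w.
    by rewrite TS /c /k /l /c1 /progress_bound; field; rewrite gt_eqF.
  have -> : T%:R * D ^+ 2 / S = S * D ^+ 2 by rewrite TS; field; rewrite gt_eqF.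
  have s20 : 0 <= 1 + S / 2 := addr_ge0 ler01 S20.
  apply: lerD => //; apply: lerD; first exact: (ler_wpM2l s20 (prog T w)).
  exact: (ler_wpM2l SD0 (Lest_le_progress_bound T w)).
rewrite (integral_affine (mE T) (mM T) (E0 T) (M0 T) iV iR c0 k0 l0) lee_fin.
have y0 : 0 <= y := mulr_ge0 c43 (addr_ge0 (addr_ge0 g0 EV0) (mulr_ge0 L2 ER0)).
rewrite ler_pdivlMr// /gap_const /L_bar.
apply: le_trans final.
(* Only one [y] is free of the factor [S]; [S >= 1] turns it into [S * y], which makes [3/2 * y] in
   total. *)
rewrite (_ : _ * S = (y + S * (y / 2 + D ^+ 2 * rho + D ^+ 2 * rho ^+ 2 / 2 * y + EV / 2)) / S).
  rewrite ler_pdivrMr//.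
  have := ler_wpM2r y0 S1; rewrite mul1r; lra.
by rewrite /c /k /l /c1 /y; field; rewrite gt_eqF.
Qed.

End Rate.

(** * Expected gaps and the number of iterations *)

Section Conclusion.
Context {R : realType} {n N b : nat} {d : measure_display} {Omega : measurableType d}.
Context (P : probability Omega R) (p : problem R n N) (rho : R) (q : nat)
  (x0 : 'rV[R]_n) (s : process R n N b d Omega).
Context (Hp : standing_assumptions p) (rho_gt0 : 0 < rho) (b_gt0 : (0 < b)%N)
  (q_gt0 : (0 < q)%N)
  (Xx0 : feasible p x0) (hx0 : (reg p x0 < +oo)%E) (Hs : alfcg_fs P p rho q x0 s).
Local Notation C := (gap_const p rho q b x0).
Local Notation G t w := (fw_gap p (iterate s t w)).

Let G0 t w : (0 <= G t w)%E.
Proof. exact: (fw_gap_ge0 Hp rho_gt0 Xx0 hx0 Hs). Qed.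

Lemma avg_gap_le T w (r : nat -> R) (z : R) :
  (forall t, (G t w <= (r t)%:E)%E) -> \sum_(t < T.+1) r t <= T.+1%:R * z ->
  (0 <= avg_gap p s T w <= z%:E)%E.
Proof.
move=> Gr rz; have i0 : (0 <= (T.+1%:R^-1 : R)%:E)%E by rewrite lee_fin invr_ge0.
apply/andP; split; first by rewrite mule_ge0// sume_ge0.
have sumG : (\sum_(t < T.+1) G t w <= (T.+1%:R * z)%:E)%E.
  apply: (@le_trans _ _ (\sum_(t < T.+1) (r t)%:E)%E); first exact: lee_sum.
  by rewrite sumEFin lee_fin.
apply: le_trans (lee_wpmul2l i0 sumG) _.
by rewrite -EFinM mulKf ?pnatr_eq0.
Qed.

Lemma min_gap_le T w (r : nat -> R) (z : R) :
  (forall t, (G t w <= (r t)%:E)%E) -> \sum_(t < T.+1) r t <= T.+1%:R * z ->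
  (0 <= min_gap p s T w <= z%:E)%E.
Proof.
move=> Gr rz.
have m0 : (0 <= min_gap p s T w)%E by apply: le_bigmin => [|t _]; rewrite ?leey.
rewrite m0/=; have mG (t : 'I_T.+1) : (min_gap p s T w <= (r t)%:E)%E.
  by apply: le_trans (Gr t); exact: bigmin_le_cond.
have mfin : min_gap p s T w \is a fin_num.
  by rewrite ge0_fin_numE//; exact: le_lt_trans (mG ord0) (ltry _).
rewrite -(fineK mfin) lee_fin -(ler_pM2l (ltr0Sn R T)).
apply: le_trans rz; rewrite mulr_natl -[X in _ *+ X](card_ord T.+1) -sumr_const.
by apply: ler_sum => t _; rewrite -lee_fin fineK.
Qed.

Lemma expected_gaps_le T :
  (\int[P]_w avg_gap p s T w <= (C / Num.sqrt T.+1%:R)%:E)%E /\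
  (\int[P]_w min_gap p s T w <= (C / Num.sqrt T.+1%:R)%:E)%E.
Proof.
have [Z Zle ZC] :=
  dominating_gap_bound Hp rho_gt0 b_gt0 q_gt0 Xx0 hx0 Hs (ltn0Sn T).
have Gr w t := fw_gap_le Hp rho_gt0 Xx0 hx0 Hs t w.
split; apply: le_trans ZC; apply: ge0_le_integral_nonmeasurable => w.
- by case/andP: (avg_gap_le (Gr w) (Zle w)).
- by case/andP: (avg_gap_le (Gr w) (Zle w)).
- by case/andP: (min_gap_le (Gr w) (Zle w)).
- by case/andP: (min_gap_le (Gr w) (Zle w)).
Qed.

Lemma min_gap_eps (eps : R) : 0 < eps ->
  exists T : nat, T%:Z = Num.ceil (C ^+ 2 * eps ^- 2 - 1) /\
    (\int[P]_w min_gap p s T w <= eps%:E)%E.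
Proof.
move=> e0; have C0 : 0 < C := gap_const_gt0 Hp rho_gt0 b_gt0 Xx0 hx0 Hs.
set y := C ^+ 2 * eps ^- 2 - 1.
(* Positivity of [C] gives [y > -1], so the ceiling is nonnegative and is a natural number. *)
have y1 : -1 < y.
  have : 0 < C ^+ 2 * eps ^- 2 by apply: divr_gt0; exact: exprn_gt0.
  rewrite /y; lra.
have cy0 : (0 <= Num.ceil y)%R by rewrite ceil_ge0.
have [T TE] : exists T : nat, T%:Z = Num.ceil y.
  by exists `|Num.ceil y|%N; rewrite gez0_abs.
exists T; split => //; apply: le_trans (expected_gaps_le T).2 _; rewrite lee_fin.
have yT : y <= T%:R by have := ceil_ge y; rewrite -TE.
have S0 : 0 < Num.sqrt (T.+1%:R : R) by rewrite sqrtr_gt0.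
rewrite ler_pdivrMr// -ler_pdivrMl// -[leLHS]ger0_norm; last first.
  by apply: mulr_ge0; rewrite ?invr_ge0 ltW.
rewrite -sqrtr_sqr ler_wsqrtr// exprMn exprVn mulrC -natr1.
by move: yT; rewrite /y lerBlDr.
Qed.

End Conclusion.

(** * Counting gradient evaluations *)

Lemma sum_dvdn (q T : nat) : (\sum_(t < T.+1) (q %| t) = T %/ q + 1)%N.
Proof.
(* The index 0 is always a multiple of [q] and accounts for the extra 1. *)
by rewrite divn_count_dvd -(big_mkord predT (fun t => (q %| t) : nat)) [LHS]big_ltn// dvdn0 addnC.
Qed.

Lemma grad_evals_le (N q b T : nat) :
  (grad_evals N q b T <= N * (T %/ q + 1) + 2 * b * T.+1)%N.
Proof.
rewrite -sum_dvdn big_distrr/= -[X in (_ <= _ + _ * X)%N](card_ord T.+1).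
rewrite -sum1_card big_distrr/= -big_split/=; apply: leq_sum => t _.
by case: ifP => _; rewrite ?muln1 ?muln0 ?leq_addr.
Qed.

(* [N / q = b = sqrt N], and the smallest sufficient horizon is below [C^2 / eps^2]. *)
Lemma grad_evals_sqrt (R : realType) (N q b T : nat) (C eps : R) :
  (0 < N)%N -> (0 < q)%N -> 0 < eps ->
  b%:R = Num.sqrt (N%:R : R) -> q%:R = Num.sqrt (N%:R : R) ->
  T%:R <= C ^+ 2 * eps ^- 2 ->
  (grad_evals N q b T)%:R
    <= (3 + 3 * C ^+ 2) * (N%:R + Num.sqrt N%:R * eps ^- 2).
Proof.
move=> N0 q0 e0 bE qE TC; set S := Num.sqrt _ in bE qE *.
have SS : S ^+ 2 = N%:R by rewrite sqr_sqrtr.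
have NS : N%:R = S * S by rewrite -expr2.
have S1 : 1 <= S by rewrite -[leLHS]sqrtr1 ler_wsqrtr// ler1n.
have S0 : 0 <= S := le_trans ler01 S1.
(* This bounds [N * (T %/ q)] by [S * T]. With [S <= N], the total is at most [3 N + 3 S T], whence
   the constant [3 + 3 C^2]. *)
have qTq : S * (T %/ q)%:R <= T%:R.
  by rewrite -qE -natrM ler_nat mulnC leq_divM.
have : (grad_evals N q b T)%:R <= N%:R * ((T %/ q)%:R + 1) + 2 * S * (T%:R + 1).
  have := grad_evals_le N q b T; rewrite -(ler_nat R) => /le_trans; apply.
  by rewrite natrD !natrM natrD -[T.+1%:R]natr1 bE.
have h1 := ler_wpM2l S0 qTq.
have h2 := ler_wpM2l S0 TC.
have h3 : S <= S * S by rewrite ler_peMl.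
have i0 : 0 <= eps ^- 2 by rewrite invr_ge0 sqr_ge0.
have h4 : 0 <= S * eps ^- 2 by rewrite mulr_ge0.
have h5 : 0 <= C ^+ 2 * (S * S) by rewrite mulr_ge0 ?sqr_ge0 ?mulr_ge0.
rewrite NS; nra.
Qed.

Theorem theorem15 (R : realType) :
  (forall (n N : nat) (p : problem R n N) (rho : R) (q b : nat)
      (x0 : 'rV[R]_n) (d : measure_display) (Omega : measurableType d)
      (P : probability Omega R) (s : process R n N b d Omega),
    standing_assumptions p ->
    0 < rho -> (0 < q)%N -> (0 < b)%N ->
    feasible p x0 -> (reg p x0 < +oo)%E ->
    alfcg_fs P p rho q x0 s ->
    let C := gap_const p rho q b x0 in
    (forall T : nat,
       (\int[P]_w avg_gap p s T w <= (C / Num.sqrt T.+1%:R)%:E)%E) /\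
    (forall eps : R, 0 < eps ->
       exists T : nat, T%:Z = Num.ceil (C ^+ 2 * eps ^- 2 - 1) /\
         (\int[P]_w min_gap p s T w <= eps%:E)%E))
  /\
  (exists A : R -> R,
    forall (n N : nat) (p : problem R n N) (rho : R) (q b : nat)
      (x0 : 'rV[R]_n) (d : measure_display) (Omega : measurableType d)
      (P : probability Omega R) (s : process R n N b d Omega),
    standing_assumptions p ->
    0 < rho -> (0 < q)%N -> (0 < b)%N ->
    feasible p x0 -> (reg p x0 < +oo)%E ->
    alfcg_fs P p rho q x0 s ->
    b%:R = Num.sqrt (N%:R : R) -> q%:R = Num.sqrt (N%:R : R) ->
    let C := gap_const p rho q b x0 in
    forall eps : R, 0 < eps ->
      exists T : nat,
        (\int[P]_w min_gap p s T w <= eps%:E)%E /\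
        (grad_evals N q b T)%:R
          <= A C * (N%:R + Num.sqrt N%:R * eps ^- 2)).
Proof.
split; last (exists (fun C => 3 + 3 * C ^+ 2)).
  move=> n N p rho q b x0 d Omega P s Hp rho0 q0 b0 Xx0 hx0 Hs /=; split.
    by move=> T; case: (expected_gaps_le Hp rho0 b0 q0 Xx0 hx0 Hs T).
  exact: (min_gap_eps Hp rho0 b0 q0 Xx0 hx0 Hs).
move=> n N p rho q b x0 d Omega P s Hp rho0 q0 b0 Xx0 hx0 Hs bE qE /= eps eps0.
have [T [TE Tgap]] := min_gap_eps Hp rho0 b0 q0 Xx0 hx0 Hs eps0.
exists T; split => //.
apply: (grad_evals_sqrt (N_gt0 Hp) q0 eps0 bE qE).
(* [ceil y - 1 < y] places the horizon strictly below [C^2 / eps^2]. *)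
have := ceilB1_lt (gap_const p rho q b x0 ^+ 2 * eps ^- 2 - 1).
by rewrite -TE intrD mulrNz ltrD2r => /ltW.
Qed.
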